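(* Fix an integer $k\ge 2$. For $n\ge k$ and $\alpha\ge0$ let $F(n,\alpha)$ be the random $k$-CNF formula on $n$ variables in which each of the $N=\binom{n}{k}2^k$ possible $k$-clauses is included independently with probability $\alpha n/N$, let $Z(F)$ be the number of satisfying assignments of $F$, and let $P_n(\alpha,\phi):=\mathbb{P}\{Z(F(n,\alpha))<2^{n\phi}\}$. For any $\varepsilon>0$ and $\phi\in[0,1)$, there exists a sequence $\{\alpha_n(\phi)\}_{n\in\mathbb{Z}_+}$ such that $$\lim_{n\to\infty}P_n(\alpha_n(\phi)-\varepsilon,\phi)=0,\qquad \lim_{n\to\infty}P_n(\alpha_n(\phi)+\varepsilon,\phi)=1.$$
   Context: A $k$-clause is a disjunction of $k$ literals on $k$ distinct variables among $x_1,\dots,x_n$; $F(n,\alpha)$ is the conjunction of the selected clauses. *)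

(* Defs.v *)
From mathcomp Require Import all_boot all_order all_algebra.
From mathcomp Require Import all_classical all_reals all_analysis.

Set Implicit Arguments.
Unset Strict Implicit.
Unset Printing Implicit Defensive.

Import Order.TTheory GRing.Theory Num.Theory.

Local Open Scope ring_scope.

(* The literal (i, b) is true under an assignment s when s i = b. *)
Definition literal (n : nat) : finType := ('I_n * bool)%type.

Definition assignment (n : nat) : finType := {ffun 'I_n -> bool}.

(* The disjunction of the literals it contains. *)
Definition clause (n : nat) : finType := {set literal n}.

(* The conjunction of the clauses it contains. *)
Definition cnf (n : nat) : finType := {set clause n}.

Definition sat_clause n (s : assignment n) (c : clause n) : bool :=
  [exists l in c, s l.1 == l.2].

Definition sat_cnf n (s : assignment n) (F : cnf n) : bool :=
  [forall c in F, sat_clause s c].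

Definition is_kclause n (k : nat) (c : clause n) : bool :=
  (#|c| == k) && (#|[set l.1 | l in c]| == k).

Definition kclauses (n k : nat) : {set clause n} :=
  finset (@is_kclause n k).

Definition nb_kclauses (n k : nat) : nat := ('C(n, k) * 2 ^ k)%N.

Definition nb_sat n (F : cnf n) : nat := #|[pred s | sat_cnf s F]|.

Section RandomFormula.
Context {R : realType}.
Implicit Types alpha phi : R.

(* This is alpha * n / N whenever that number lies in [0, 1], and its
   projection onto [0, 1] otherwise; in particular a negative alpha yields the
   empty formula almost surely.  The truncation is needed because alpha is
   shifted by a fixed amount in both directions. *)
Definition clause_prob (n k : nat) alpha : R :=
  Num.min 1 (Num.max 0 (alpha * n%:R / (nb_kclauses n k)%:R)).

(* Probability that the random formula is F, for F a set of k-clauses. *)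
Definition cnf_prob (n k : nat) alpha (F : cnf n) : R :=
  let p := clause_prob n k alpha in
  \prod_(c in kclauses n k) (if c \in F then p else 1 - p).

Definition cnf_event_prob (n k : nat) alpha (E : pred (cnf n)) : R :=
  \sum_(F in powerset (kclauses n k) | E F) cnf_prob k alpha F.

Definition P_few_sat (n k : nat) alpha phi : R :=
  cnf_event_prob k alpha [pred F : cnf n | (nb_sat F)%:R < 2 `^ (n%:R * phi)].

End RandomFormula.

(* Main.v *)
Require Import Defs.
From mathcomp Require Import all_boot all_order all_algebra.
From mathcomp Require Import all_classical all_reals all_analysis.
From mathcomp Require Import ring lra zify polyrcf finset perm.

(** Write P(alpha) for the probability that Z < theta = 2^(n phi).  If the
    window of P were wider than eps, then P would have derivative O(1) at many
    points alpha of that window.  At such a point the total influence of the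
    event is bounded, so its Fourier weight sits on sets of bounded size, and
    global hypercontractivity (in the form of Keevash, Lifshitz, Long and
    Minzer) yields a bounded set U of clauses with E (D_U f)^2 bounded below,
    where D_U is the iterated discrete derivative: planting U raises P by a
    constant.  Sets of clauses violating Hall's condition on their variables
    carry vanishing Fourier weight, so U may be taken to satisfy it; U is then
    implied by at most |U| literals on distinct variables, and by symmetry
    fixing D random literals raises P by a constant.  By Jensen's inequality D
    random k-clauses then bring Z below k^D theta with probability bounded
    below, and boundedly many more clauses absorb the factor k^D.  As any
    increment of alpha adds unboundedly many clauses, P jumps by a constant
    just after each point with bounded derivative, which can only happen
    boundedly often. *)

Set Implicit Arguments.
Unset Strict Implicit.
Unset Printing Implicit Defensive.

Import Order.TTheory GRing.Theory Num.Theory.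
Import numFieldNormedType.Exports.

Local Open Scope ring_scope.

(** * Product measures on subsets *)

(** The clause probability q has order n/N and tends to 0, where classical hypercontractive
    constants blow up. The version used keeps derivative norms on its right-hand side, and for a
    monotone indicator a large derivative norm signals a profitable planting. As theta may be
    exponentially large, trading a literal for a k-clause is not free: it can multiply the number of
    survivors by k. The resulting factor k^D is paid back by m further clauses, each keeping an
    assignment with probability 1 - 2^-k. At this stage M = D + m random tuples succeed with only a
    small positive probability. It is amplified: the increment is split into M + 1 equal parts, and
    each of M batches of clauses need only hit a dense set of good tuples, which almost surely
    happens for large n. Hence the jump c depends on the derivative bound but not on the length of
    the increment, and the number J of steps in the window can be chosen after c. The condition k >=
    2 gives n q = O(1), which makes j clauses on j - 1 variables rare. *)

Definition prod_weight (R : comNzRingType) (T : finType) (p : T -> R)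
    (F : {set T}) : R :=
  \prod_e (if e \in F then p e else 1 - p e).

(** The ring is general because [p] later takes polynomial values: the mean is then a polynomial in
    the clause probability and can be differentiated. *)
Definition prod_mean (R : comNzRingType) (T : finType) (p : T -> R)
    (f : {set T} -> R) : R :=
  \sum_(F : {set T}) prod_weight p F * f F.

Lemma sum_prod_mem (R : comNzRingType) (T : finType) (u : T -> bool -> R) :
  \sum_(F : {set T}) \prod_e u e (e \in F) = \prod_e (u e true + u e false).
Proof.
rewrite bigA_distr; apply: eq_bigr => F _; apply: eq_bigr => e _.
by case: (e \in F).
Qed.

Section ProductMean.
Variables (R : comNzRingType) (T : finType) (p : T -> R).

Lemma prod_meanD f g :
  prod_mean p (fun F => f F + g F) = prod_mean p f + prod_mean p g.
Proof. by rewrite -big_split; apply: eq_bigr => F _; rewrite mulrDr. Qed.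

Lemma prod_meanZ a f : prod_mean p (fun F => a * f F) = a * prod_mean p f.
Proof. by rewrite mulr_sumr; apply: eq_bigr => F _; rewrite mulrCA. Qed.

Lemma prod_meanN f : prod_mean p (fun F => - f F) = - prod_mean p f.
Proof. by rewrite -sumrN; apply: eq_bigr => F _; rewrite mulrN. Qed.

Lemma prod_meanB f g :
  prod_mean p (fun F => f F - g F) = prod_mean p f - prod_mean p g.
Proof. by rewrite prod_meanD prod_meanN. Qed.

Lemma prod_mean_sum (I : Type) (s : seq I) (P : pred I) (f : I -> {set T} -> R) :
  prod_mean p (fun F => \sum_(i <- s | P i) f i F) =
  \sum_(i <- s | P i) prod_mean p (f i).
Proof. by rewrite exchange_big; apply: eq_bigr => F _; rewrite mulr_sumr. Qed.

Lemma prod_mean_prod (u : T -> bool -> R) :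
  prod_mean p (fun F => \prod_e u e (e \in F)) =
  \prod_e (p e * u e true + (1 - p e) * u e false).
Proof.
rewrite -(@sum_prod_mem _ _ (fun e b => (if b then p e else 1 - p e) * u e b)).
by apply: eq_bigr => F _; rewrite -big_split.
Qed.

Lemma prod_mean_cst a : prod_mean p (fun=> a) = a.
Proof.
rewrite -[a]mulr1 prod_meanZ; congr (_ * _).
have := @prod_mean_prod (fun _ _ => 1).
under eq_fun do rewrite big1 //; move=> ->.
by rewrite big1 // => e _; rewrite !mulr1 addrC subrK.
Qed.

Lemma eq_prod_mean f g : f =1 g -> prod_mean p f = prod_mean p g.
Proof. by move=> fg; apply: eq_bigr => F _; rewrite fg. Qed.

Lemma sum_mem_notin (e : T) (g : {set T} -> R) :
  \sum_(F : {set T}) g F =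
  \sum_(F : {set T} | e \notin F) (g (e |: F) + g F).
Proof.
rewrite (bigID [pred F : {set T} | e \in F]) /= big_split /=; congr (_ + _).
rewrite (reindex_onto (fun F => e |: F) (fun F => F :\ e)) /=; last first.
  by move=> F eF; rewrite setD1K.
apply: eq_bigl => F; rewrite setU11 /=.
apply/eqP/idP => [<-|]; first by rewrite !inE eqxx.
by move=> eF; rewrite setU1K.
Qed.

Lemma prod_weight_setU1 e (F : {set T}) : e \notin F ->
  prod_weight p (e |: F) =
  p e * \prod_(x | x != e) (if x \in F then p x else 1 - p x).
Proof.
move=> eF; rewrite /prod_weight (bigD1 e) //= setU11; congr (_ * _).
by apply: eq_bigr => x xe; rewrite !inE (negPf xe).
Qed.

Lemma prod_weight_notin e (F : {set T}) : e \notin F ->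
  prod_weight p F =
  (1 - p e) * \prod_(x | x != e) (if x \in F then p x else 1 - p x).
Proof. by move=> eF; rewrite /prod_weight (bigD1 e) //= (negPf eF). Qed.

Lemma prod_mean_notin e f :
  prod_mean p f = \sum_(F : {set T} | e \notin F)
     (\prod_(x | x != e) (if x \in F then p x else 1 - p x)) *
     (p e * f (e |: F) + (1 - p e) * f F).
Proof.
rewrite /prod_mean (sum_mem_notin e); apply: eq_bigr => F eF.
by rewrite (prod_weight_setU1 eF) (prod_weight_notin eF); ring.
Qed.

Lemma prod_mean_avg e f :
  prod_mean p f =
  prod_mean p (fun F => p e * f (e |: F) + (1 - p e) * f (F :\ e)).
Proof.
rewrite 2!(prod_mean_notin e); apply: eq_bigr => F eF.
have -> : F :\ e = F by apply/setDidPl; rewrite disjoint_sym disjoints1.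
have -> : e |: (e |: F) = e |: F by rewrite setUA setUid.
by rewrite setU1K //; ring.
Qed.

End ProductMean.

Section ProductMeanOrder.
Variables (R : realType) (T : finType) (p : T -> R).
Hypothesis p01 : forall e, 0 <= p e <= 1.

Lemma prod_weight_ge0 F : 0 <= prod_weight p F.
Proof.
apply: prodr_ge0 => e _; have /andP[p0 p1] := p01 e.
by case: ifP => // _; rewrite subr_ge0.
Qed.

Lemma ler_prod_mean f g :
  (forall F, f F <= g F) -> prod_mean p f <= prod_mean p g.
Proof.
by move=> fg; apply: ler_sum => F _; rewrite ler_wpM2l // prod_weight_ge0.
Qed.

Lemma prod_mean_ge0 f : (forall F, 0 <= f F) -> 0 <= prod_mean p f.
Proof. by move=> f0; rewrite -[0](prod_mean_cst p); apply: ler_prod_mean. Qed.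

End ProductMeanOrder.

(** The union of independent random sets has independent coordinates. This is the coupling behind
    monotonicity in the density and behind adding clauses in batches. *)
Lemma prod_mean_setU (R : comNzRingType) (T : finType) (p q : T -> R) f :
  prod_mean p (fun F => prod_mean q (fun G => f (F :|: G))) =
  prod_mean (fun e => p e + q e - p e * q e) f.
Proof.
(* Expanding [f] in point masses reduces the claim to the event that the union is [K], which factors
   over coordinates. *)
have fE (H : {set T}) :
    f H = \sum_(K : {set T}) (\prod_e ((e \in H) == (e \in K))%:R) * f K.
  rewrite (bigD1 H) //= [X in _ + X]big1 ?addr0 => [|K KH].
    by rewrite big1 ?mul1r // => e _; rewrite eqxx.
  have [e eHK] : exists e, (e \in H) != (e \in K).
    apply/existsP; rewrite -negb_forall; apply: contra KH => /forallP HK.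
    by apply/eqP/setP => e; rewrite (eqP (HK e)).
  by rewrite (bigD1 e) //= (negPf eHK) !mul0r.
transitivity (\sum_(K : {set T}) f K *
    prod_mean p (fun F => prod_mean q (fun G =>
      \prod_e (((e \in F) || (e \in G)) == (e \in K))%:R))).
  under eq_prod_mean => F.
    under eq_prod_mean => G.
      rewrite fE; under eq_bigr => K _ do rewrite mulrC.
      over.
    rewrite prod_mean_sum; under eq_bigr => K _ do rewrite prod_meanZ.
    over.
  rewrite prod_mean_sum; apply: eq_bigr => K _; rewrite prod_meanZ.
  congr (_ * _); apply: eq_prod_mean => F; apply: eq_prod_mean => G.
  by apply: eq_bigr => e _; rewrite inE.
rewrite /prod_mean; apply: eq_bigr => K _; rewrite mulrC; congr (_ * _).
under eq_bigr => F _ do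
  rewrite -/(prod_mean q _)
    (prod_mean_prod q (fun e b => (((e \in F) || b) == (e \in K))%:R)).
rewrite -/(prod_mean p _) (prod_mean_prod p (fun e a =>
  q e * ((a || true) == (e \in K))%:R
  + (1 - q e) * ((a || false) == (e \in K))%:R)).
by apply: eq_bigr => e _; case: (e \in K) => /=; ring.
Qed.

(** * Fourier expansion and global hypercontractivity *)

Section Chaos.
Variables (R : realType) (T : finType) (p : T -> R).
Implicit Types (c d : {set T} -> R) (S U F : {set T}).

(** The variables are centred but not divided by their standard deviation, since [p e] may be 0 or
    1; the variances reappear as the weights [bvars S]. *)
Definition centered e F : R := (e \in F)%:R - p e.
Definition bvar e : R := p e * (1 - p e).
Definition monom S F : R := \prod_(e in S) centered e F.
Definition bvars S : R := \prod_(e in S) bvar e.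

Definition chaos c F : R := \sum_S c S * monom S F.

(* [chaos (cderiv U c)] is the iterated discrete derivative of [chaos c] in the
   directions of [U], and [cnorm2] is the squared L2 norm. *)
Definition cderiv U c S : R := if [disjoint S & U] then c (S :|: U) else 0.

Definition cnorm2 c : R := \sum_S c S ^+ 2 * bvars S.

(** Coefficients of the conditional expectation that averages out the coordinate [e]. *)
Definition cavg e c S : R := if e \in S then 0 else c S.

Lemma monom_mean S S' :
  prod_mean p (fun F => monom S F * monom S' F) = (S == S')%:R * bvars S.
Proof.
pose u e (b : bool) : R :=
  (if e \in S then b%:R - p e else 1) * (if e \in S' then b%:R - p e else 1).
have -> : prod_mean p (fun F => monom S F * monom S' F) =
    prod_mean p (fun F => \prod_e u e (e \in F)).
  apply: eq_prod_mean => F; rewrite big_split /monom.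
  by rewrite [in LHS]big_mkcond [X in _ * X = _]big_mkcond.
rewrite prod_mean_prod /u; have [<-|SS'] := eqVneq S S'.
  rewrite mul1r /bvars [RHS]big_mkcond; apply: eq_bigr => e _.
  by rewrite /bvar; case: ifP => _ /=; ring.
have [e eSS'] : exists e, (e \in S) != (e \in S').
  apply/existsP; rewrite -negb_forall; apply: contra SS' => /forallP HK.
  by apply/eqP/setP => e; rewrite (eqP (HK e)).
rewrite mul0r (bigD1 e) //=; move: eSS'.
by case: (e \in S); case: (e \in S') => // _; rewrite [X in X * _](_ : _ = 0) ?mul0r //=; ring.
Qed.

Lemma chaos_mean c d :
  prod_mean p (fun F => chaos c F * chaos d F) = \sum_S c S * d S * bvars S.
Proof.
transitivity (\sum_S \sum_S' c S * d S' *
    prod_mean p (fun F => monom S F * monom S' F)).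
  under [RHS]eq_bigr => S _.
    under eq_bigr => S' _ do rewrite -prod_meanZ.
    rewrite -prod_mean_sum.
    over.
  rewrite -prod_mean_sum; apply: eq_prod_mean => F.
  rewrite /chaos mulr_suml; apply: eq_bigr => S _.
  by rewrite mulr_sumr; apply: eq_bigr => S' _; ring.
apply: eq_bigr => S _; rewrite (bigD1 S) //= monom_mean eqxx mul1r.
rewrite [X in _ + X]big1 ?addr0 // => S' S'S.
by rewrite monom_mean eq_sym (negPf S'S) mul0r mulr0.
Qed.

Lemma chaos_mean2 c : prod_mean p (fun F => chaos c F ^+ 2) = cnorm2 c.
Proof.
by have := chaos_mean c c; under eq_prod_mean do rewrite -expr2.
Qed.

(* Expand the indicator of [G = F] as the product over [e] of
   [sg e G * centered e F + mu e G]. *)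
Lemma chaos_exists (f : {set T} -> R) : exists c, f =1 chaos c.
Proof.
pose sg e (G : {set T}) : R := if e \in G then 1 else -1.
pose mu e (G : {set T}) : R := if e \in G then p e else 1 - p e.
exists (fun S => \sum_G f G *
  (\prod_(e in S) sg e G * \prod_(e | e \notin S) mu e G)) => F.
rewrite /chaos.
transitivity (\sum_G f G * \prod_e (sg e G * centered e F + mu e G)).
  rewrite (bigD1 F) //= big1 => [|e _]; last first.
    by rewrite /sg /mu /centered; case: (e \in F) => /=; ring.
  rewrite mulr1 big1 ?addr0 // => G GF.
  have [e eGF] : exists e, (e \in G) != (e \in F).
    apply/existsP; rewrite -negb_forall; apply: contra GF => /forallP HK.
    by apply/eqP/setP => e; rewrite (eqP (HK e)).
  rewrite (bigD1 e) //= [X in _ * (X * _)](_ : _ = 0) ?mul0r ?mulr0 //.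
  by move: eGF; rewrite /sg /mu /centered; case: (e \in G); case: (e \in F) => //= _; ring.
under eq_bigr => G _ do rewrite bigA_distr mulr_sumr.
rewrite exchange_big; apply: eq_bigr => S _.
rewrite mulr_suml; apply: eq_bigr => G _; rewrite -!mulrA; congr (_ * _).
rewrite (bigID [in S]) /= [RHS]mulrCA [RHS]mulrC; congr (_ * _); last first.
  by apply: eq_bigr => e /negPf ->.
by rewrite /monom -big_split; apply: eq_bigr => e ->.
Qed.

Lemma chaos_invar c e F F' : (forall S, e \in S -> c S = 0) ->
  (forall x, x != e -> (x \in F) = (x \in F')) -> chaos c F = chaos c F'.
Proof.
move=> c0 FF'; apply: eq_bigr => S _; have [eS|eS] := boolP (e \in S).
  by rewrite c0 // !mul0r.
congr (_ * _); apply: eq_bigr => x xS; rewrite /centered FF' //.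
by apply: contraNneq eS => <-.
Qed.

Lemma cderiv1E e c S : cderiv [set e] c S = if e \in S then 0 else c (e |: S).
Proof.
by rewrite /cderiv disjoint_sym disjoints1 finset.setUC; case: (e \in S).
Qed.

Lemma cderiv1_mem e c S : e \in S -> cderiv [set e] c S = 0.
Proof. by rewrite cderiv1E => ->. Qed.

Lemma cavg_mem e c S : e \in S -> cavg e c S = 0.
Proof. by rewrite /cavg => ->. Qed.

Lemma sum_split_mem (e : T) (g : {set T} -> R) :
  \sum_S g S = \sum_(S : {set T} | e \notin S) g S
             + \sum_(S : {set T} | e \notin S) g (e |: S).
Proof. by rewrite (sum_mem_notin e) big_split addrC. Qed.

Lemma sum_notin (e : T) (g : {set T} -> R) :
  (forall S, e \in S -> g S = 0) -> \sum_(S : {set T} | e \notin S) g S = \sum_S g S.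
Proof.
move=> g0; rewrite [RHS](sum_split_mem e) [X in _ = _ + X]big1 ?addr0 //.
by move=> S eS; rewrite g0 // setU11.
Qed.

Lemma chaos_split e c F :
  chaos c F = chaos (cavg e c) F + centered e F * chaos (cderiv [set e] c) F.
Proof.
rewrite /chaos (sum_split_mem e); congr (_ + _).
  rewrite -[RHS](sum_notin (e := e)) => [|S eS]; last by rewrite cavg_mem ?mul0r.
  by apply: eq_bigr => S /negPf eS; rewrite /cavg eS.
rewrite -[X in _ = _ * X](sum_notin (e := e)) => [|S eS]; last first.
  by rewrite cderiv1_mem ?mul0r.
rewrite mulr_sumr; apply: eq_bigr => S eS.
by rewrite cderiv1E (negPf eS) /monom big_setU1 //=; ring.
Qed.

Lemma chaos_cderiv1 e c F :
  chaos (cderiv [set e] c) F = chaos c (e |: F) - chaos c (F :\ e).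
Proof.
have inU d : (forall S, e \in S -> d S = 0) -> chaos d (e |: F) = chaos d F.
  by move=> d0; apply: (chaos_invar d0) => x xe; rewrite !inE (negPf xe).
have inD d : (forall S, e \in S -> d S = 0) -> chaos d (F :\ e) = chaos d F.
  by move=> d0; apply: (chaos_invar d0) => x xe; rewrite !inE xe.
have a0 := @cavg_mem e c; have b0 := @cderiv1_mem e c.
rewrite (chaos_split e c (e |: F)) (chaos_split e c (F :\ e)).
rewrite (inU _ a0) (inU _ b0) (inD _ a0) (inD _ b0).
by rewrite /centered !inE eqxx /=; ring.
Qed.

Lemma cderivU1 e U c : e \notin U ->
  cderiv (e |: U) c =1 cderiv U (cderiv [set e] c).
Proof.
move=> eU S; rewrite /cderiv -/(cderiv [set e] c _) cderiv1E inE (negPf eU) orbF.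
rewrite -setI_eq0 finset.setIUr setU_eq0 !setI_eq0 disjoint_sym disjoints1.
case: (e \in S) => /=; first by rewrite if_same.
by case: ifP => // _; rewrite finset.setUCA.
Qed.

Lemma cderiv0 c : cderiv finset.set0 c =1 c.
Proof. by move=> S; rewrite /cderiv -setI_eq0 finset.setI0 eqxx finset.setU0. Qed.

Lemma bvarsU1 e S : e \notin S -> bvars (e |: S) = bvar e * bvars S.
Proof. by move=> eS; rewrite /bvars big_setU1. Qed.

Lemma eq_cnorm2 c d : c =1 d -> cnorm2 c = cnorm2 d.
Proof. by move=> cd; apply: eq_bigr => S _; rewrite cd. Qed.

Lemma cnorm2_split e c :
  cnorm2 c = cnorm2 (cavg e c) + bvar e * cnorm2 (cderiv [set e] c).
Proof.
rewrite /cnorm2 (sum_split_mem e); congr (_ + _).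
  rewrite -[RHS](sum_notin (e := e)) => [|S eS]; last by rewrite cavg_mem ?expr0n ?mul0r.
  by apply: eq_bigr => S /negPf eS; rewrite /cavg eS.
rewrite -[X in _ = _ * X](sum_notin (e := e)) => [|S eS]; last first.
  by rewrite cderiv1_mem ?expr0n ?mul0r.
rewrite mulr_sumr; apply: eq_bigr => S eS.
by rewrite cderiv1E (negPf eS) bvarsU1 //; ring.
Qed.

(** Turns derivative norms into Fourier weight: for a singleton this is the weight behind the
    influence, for larger [U] it controls the weight of all supersets of [U]. *)
Lemma cnorm2_cderiv U c :
  bvars U * cnorm2 (cderiv U c) =
  \sum_(S : {set T} | U \subset S) c S ^+ 2 * bvars S.
Proof.
rewrite /cnorm2 mulr_sumr (bigID [pred S : {set T} | [disjoint S & U]]) /=.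
rewrite [X in _ + X]big1 ?addr0 => [|S /negPf SU]; last first.
  by rewrite /cderiv SU expr0n mul0r mulr0.
rewrite [RHS](reindex_onto (fun S => S :|: U) (fun S => S :\: U)) /=; last first.
  move=> S /fintype.subsetP/(_ _)/implyP US; apply/setP => x; have := US x.
  by rewrite !inE; case: (x \in U); case: (x \in S).
apply: eq_big => [S|S SU].
  rewrite finset.subsetUr /= finset.setDUl finset.setDv finset.setU0.
  by apply/idP/eqP => [/setDidPl//|/setDidPl].
rewrite /cderiv SU /bvars [X in _ = _ * X](eq_bigl [predU S & U]) => [|x]; last first.
  by rewrite !inE.
rewrite [X in _ = _ * X]bigU //=.
by rewrite mulrCA [X in _ = _ * X]mulrC.
Qed.

End Chaos.

(* With [A], [B], [X] the weighted sums of [a_i^2], [b_i^2] and [a_i b_i], the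
   left-hand side is the mean of [(sum_i w_i (a_i + om b_i / 2)^2)^2] over a
   centered p-biased bit [om]. *)
Lemma two_point_fourth_moment (R : realFieldType) (p A B X : R) :
  0 <= p <= 1 -> 0 <= A -> 0 <= B -> X ^+ 2 <= A * B ->
  p * (A + (1 - p) * X + (1 - p) ^+ 2 / 4 * B) ^+ 2
    + (1 - p) * (A - p * X + p ^+ 2 / 4 * B) ^+ 2
  <= (A + p * (1 - p) * B) ^+ 2 + p * (1 - p) * B ^+ 2.
Proof.
move=> /andP[p0 p1] A0 B0 XAB; rewrite -subr_ge0.
have v0 : 0 <= p * (1 - p) by rewrite mulr_ge0 // subr_ge0.
have XB : 2 * ((1 - 2 * p) * X * B) <= X ^+ 2 + B ^+ 2.
  have := sqr_ge0 (X - (1 - 2 * p) * B).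
  have : 0 <= (p * (1 - p)) * B ^+ 2 by rewrite mulr_ge0 ?sqr_ge0.
  by nra.
have vB : 0 <= (p * (1 - p)) * B ^+ 2 by rewrite mulr_ge0 ?sqr_ge0.
have B2 : 0 <= B ^+ 2 by rewrite sqr_ge0.
have AB : 0 <= A * B by rewrite mulr_ge0.
(* Right side minus left side is [p (1 - p)] times this bracket, which is nonnegative by
   [X ^+ 2 <= A * B] and [XB]. *)
have := mulr_ge0 v0 (_ : 0 <= 3 / 2 * (A * B) + (1 + p * (1 - p)) * B ^+ 2
  - X ^+ 2 - (1 - 3 * (p * (1 - p))) / 16 * B ^+ 2 - (1 - 2 * p) * X * B / 2).
move=> /(_ _)/le_trans; apply; last by rewrite le_eqVlt; apply/orP; left; apply/eqP; field.
by lra.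
Qed.

Lemma weighted_cauchy (R : realFieldType) (I : finType) (w a b : I -> R) :
  (forall i, 0 <= w i) ->
  (\sum_i w i * (a i * b i)) ^+ 2 <=
  (\sum_i w i * a i ^+ 2) * (\sum_i w i * b i ^+ 2).
Proof.
move=> w0; set A := \sum_i w i * a i ^+ 2; set B := \sum_i w i * b i ^+ 2.
set X := \sum_i _.
have q t : 0 <= A + 2 * t * X + t ^+ 2 * B.
  rewrite /A /B /X !mulr_sumr -!big_split; apply: sumr_ge0 => i _ /=.
  rewrite (_ : _ + _ = w i * (a i + t * b i) ^+ 2); last by ring.
  by rewrite mulr_ge0 ?sqr_ge0.
have B0 : 0 <= B by apply: sumr_ge0 => i _; rewrite mulr_ge0 ?sqr_ge0.
have [B00|Bn0] := eqVneq B 0.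
  have [->|X0] := eqVneq X 0; first by rewrite B00 mulr0 expr0n.
  have := q (- (A + 1) / (2 * X)).
  rewrite B00 mulr0 addr0 (_ : _ + _ = -1); last by field.
  by rewrite oppr_ge0 ler10.
have Bp : 0 < B by rewrite lt_def Bn0.
have := q (- X / B); rewrite (_ : _ + _ = (A * B - X ^+ 2) / B); last by field.
by rewrite pmulr_lge0 ?invr_gt0 // subr_ge0.
Qed.

Section Hypercontractivity.
Variables (R : realType) (T : finType) (p : T -> R).
Hypothesis p01 : forall e, 0 <= p e <= 1.
Implicit Types (c d : {set T} -> R) (S U F J : {set T}).

Definition noise c S : R := 2^-1 ^+ #|S| * c S.

Lemma bvar_ge0 e : 0 <= bvar p e.
Proof. by have /andP[p0 p1] := p01 e; rewrite mulr_ge0 // subr_ge0. Qed.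

Lemma bvars_ge0 S : 0 <= bvars p S.
Proof. by apply: prodr_ge0 => e _; apply: bvar_ge0. Qed.

Lemma cnorm2_ge0 c : 0 <= cnorm2 p c.
Proof. by apply: sumr_ge0 => S _; rewrite mulr_ge0 ?sqr_ge0 ?bvars_ge0. Qed.

Lemma chaos_noise_split e c F :
  chaos p (noise c) F = chaos p (noise (cavg e c)) F
    + centered p e F / 2 * chaos p (noise (cderiv [set e] c)) F.
Proof.
rewrite (chaos_split _ e) -mulrA [_^-1 * _]mulr_sumr; congr (_ + _ * _).
  apply: eq_bigr => S _; congr (_ * _); rewrite /noise /cavg.
  by case: ifP => // _; rewrite mulr0.
apply: eq_bigr => S _; rewrite mulrA; congr (_ * _); rewrite /noise !cderiv1E.
case: (boolP (e \in S)) => eS; first by rewrite !mulr0.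
by rewrite cardsU1 eS add1n exprS mulrA.
Qed.

Lemma cderiv_vanish e U c : (forall S, e \in S -> c S = 0) -> e \in U ->
  cnorm2 p (cderiv U c) = 0.
Proof.
move=> c0 eU; apply: big1 => S _; rewrite /cderiv; case: ifP => _.
  by rewrite c0 ?expr0n ?mul0r // inE eU orbT.
by rewrite expr0n mul0r.
Qed.

Lemma cnorm2_cderiv_split e U c : e \notin U ->
  cnorm2 p (cderiv U c) = cnorm2 p (cderiv U (cavg e c))
    + bvar p e * cnorm2 p (cderiv U (cderiv [set e] c)).
Proof.
move=> eU; rewrite (cnorm2_split _ e); congr (_ + _ * _); apply: eq_cnorm2 => S.
  rewrite /cavg /cderiv inE (negPf eU) orbF.
  by case: (e \in S) => //; rewrite if_same.
rewrite cderiv1E /cderiv -/(cderiv [set e] c _) cderiv1E inE (negPf eU) orbF.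
rewrite -[[disjoint e |: S & U]]setI_eq0 finset.setIUl setU_eq0 !setI_eq0 disjoints1 eU /=.
case: (e \in S) => /=; first by rewrite if_same.
by case: ifP => // _; rewrite finset.setUA.
Qed.

(* Weighted families are needed for the induction: removing the coordinate [e]
   replaces the family [c] by the [cavg e (c i)] with weights [w i] together
   with the [cderiv [set e] (c i)] with weights [bvar p e * w i]. *)
Lemma global_hypercontractivity_on (n : nat) (J : {set T}) (I : finType)
    (w : I -> R) (c : I -> {set T} -> R) :
  #|J| = n -> (forall i, 0 <= w i) ->
  (forall i S, ~~ (S \subset J) -> c i S = 0) ->
  prod_mean p (fun F => (\sum_i w i * chaos p (noise (c i)) F ^+ 2) ^+ 2) <=
  \sum_U bvars p U * (\sum_i w i * cnorm2 p (cderiv U (c i))) ^+ 2.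
Proof.
elim: n J I w c => [|n IH] J I w c cJ w0 cS.
  have J0 : J = finset.set0 by apply/eqP; rewrite -cards_eq0 cJ.
  have c0 i S : S != finset.set0 -> c i S = 0.
    by move=> S0; apply: cS; rewrite J0 subset0.
  rewrite (bigD1 finset.set0) //= [leLHS](_ : _ = (\sum_i w i * c i finset.set0 ^+ 2) ^+ 2).
    rewrite ler_wpDr //.
      by apply: sumr_ge0 => U _; rewrite mulr_ge0 ?sqr_ge0 ?bvars_ge0.
    rewrite /bvars big_set0 mul1r le_eqVlt; apply/orP; left; apply/eqP.
    congr (_ ^+ 2); apply: eq_bigr => i _; congr (_ * _).
    rewrite (eq_cnorm2 _ (@cderiv0 _ _ (c i))) /cnorm2 (bigD1 finset.set0) //=.
    rewrite /bvars big_set0 mulr1 big1 ?addr0 // => S S0.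
    by rewrite c0 // expr0n mul0r.
  rewrite -[RHS](prod_mean_cst p); apply: eq_prod_mean => F.
  congr (_ ^+ 2); apply: eq_bigr => i _; congr (_ * _ ^+ 2).
  rewrite /chaos (bigD1 finset.set0) //= big1 ?addr0 => [|S S0].
    by rewrite /noise /monom big_set0 cards0 expr0 mul1r mulr1.
  by rewrite /noise c0 // mulr0 mul0r.
have /card_gt0P[e eJ] : (0 < #|J|)%N by rewrite cJ.
have cJe : #|J :\ e| = n by have := cardsD1 e J; rewrite cJ eJ => -[].
pose a i := cavg e (c i); pose b i := cderiv [set e] (c i).
pose A F := \sum_i w i * chaos p (noise (a i)) F ^+ 2.
pose B F := \sum_i w i * chaos p (noise (b i)) F ^+ 2.
have aS i S : ~~ (S \subset J :\ e) -> a i S = 0.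
  rewrite /a /cavg; case: ifP => // eS SJ; apply: cS; apply: contra SJ => SJ.
  by rewrite subsetD1 SJ eS.
have bS i S : ~~ (S \subset J :\ e) -> b i S = 0.
  rewrite /b cderiv1E; case: ifP => // eS SJ; apply: cS; apply: contra SJ.
  by rewrite finset.subUset subsetD1 eS => /andP[_ ->].
(* The two-point inequality for the bit [e] separates the sets [U] avoiding [e] (first summand) from
   those containing it (second summand). *)
apply: (@le_trans _ _ (prod_mean p (fun F => (A F + bvar p e * B F) ^+ 2)
                     + bvar p e * prod_mean p (fun F => B F ^+ 2))).
  rewrite -prod_meanZ -prod_meanD (prod_mean_avg _ e).
  apply: ler_prod_mean => // F.
  pose X := \sum_i w i * (chaos p (noise (a i)) F * chaos p (noise (b i)) F).
  have split_at F' : (forall x, x != e -> (x \in F') = (x \in F)) ->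
      \sum_i w i * chaos p (noise (c i)) F' ^+ 2 =
      A F + centered p e F' * X + centered p e F' ^+ 2 / 4 * B F.
    move=> F'F; rewrite /A /B /X !mulr_sumr -!big_split; apply: eq_bigr => i _ /=.
    rewrite (chaos_noise_split e) (@chaos_invar _ _ _ _ e F' F) //; last first.
      by move=> S eS; rewrite /noise cavg_mem ?mulr0.
    rewrite (@chaos_invar _ _ _ (noise (cderiv _ _)) e F' F) //; last first.
      by move=> S eS; rewrite /noise cderiv1_mem ?mulr0.
    by rewrite /a /b; field.
  rewrite (split_at (e |: F)); last by move=> x xe; rewrite !inE (negPf xe).
  rewrite (split_at (F :\ e)); last by move=> x xe; rewrite !inE xe.
  rewrite /centered !inE eqxx /= sub0r mulNr sqrrN.
  apply: two_point_fourth_moment => //.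
  - by apply: sumr_ge0 => i _; rewrite mulr_ge0 ?sqr_ge0.
  - by apply: sumr_ge0 => i _; rewrite mulr_ge0 ?sqr_ge0.
  - exact: weighted_cauchy.
rewrite [leRHS](sum_split_mem e); apply: lerD.
  pose w' (i : I + I) := match i with inl i => w i | inr i => bvar p e * w i end.
  pose c' (i : I + I) := match i with inl i => a i | inr i => b i end.
  have sum_c' (N : ({set T} -> R) -> R) : \sum_i w' i * N (c' i) =
      \sum_i w i * N (a i) + bvar p e * \sum_i w i * N (b i).
    rewrite big_sumType /= mulr_sumr; congr (_ + _).
    by apply: eq_bigr => i _; rewrite mulrA.
  have w'0 i : 0 <= w' i by case: i => i //=; rewrite mulr_ge0 // bvar_ge0.
  have c'S i S : ~~ (S \subset J :\ e) -> c' i S = 0.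
    by case: i => i; [apply: aS|apply: bS].
  have := IH (J :\ e) (I + I)%type w' c' cJe w'0 c'S.
  under eq_prod_mean => F do
    rewrite (sum_c' (fun c => chaos p (noise c) F ^+ 2)) -/(A F) -/(B F).
  move/le_trans; apply; rewrite -[leLHS](sum_notin (e := e)) => [|U eU]; last first.
    rewrite big1 ?expr0n ?mulr0 // => i _; rewrite (cderiv_vanish (e := e)) ?mulr0 //.
    by move=> S eS; apply: c'S; apply/negP => /fintype.subsetP/(_ _ eS); rewrite !inE eqxx.
  apply: ler_sum => U eU; rewrite (sum_c' (fun c => cnorm2 p (cderiv U c))).
  rewrite le_eqVlt; apply/orP; left; apply/eqP; congr (_ * _ ^+ 2).
  rewrite mulr_sumr -big_split; apply: eq_bigr => i _ /=.
  rewrite [RHS](_ : _ = w i * (cnorm2 p (cderiv U (a i))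
    + bvar p e * cnorm2 p (cderiv U (b i)))) ?(cnorm2_cderiv_split (c i) eU) //.
  by ring.
have := IH (J :\ e) I w b cJe w0 bS.
move/(ler_wpM2l (bvar_ge0 e))/le_trans; apply.
rewrite -[X in _ * X](sum_notin (e := e)) => [|U eU]; last first.
  rewrite big1 ?expr0n ?mulr0 // => i _; rewrite (cderiv_vanish (e := e)) ?mulr0 //.
  by move=> S eS; apply: bS; apply/negP => /fintype.subsetP/(_ _ eS); rewrite !inE eqxx.
rewrite mulr_sumr; apply: ler_sum => U eU; rewrite bvarsU1 // mulrA.
rewrite le_eqVlt; apply/orP; left; apply/eqP; congr (_ * _ ^+ 2).
apply: eq_bigr => i _; congr (_ * _); apply: eq_cnorm2 => S.
by rewrite cderivU1.
Qed.

(** The case of a one-element family. For small [p] the fourth moment is not controlled by the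
    variance alone; the derivative terms account for functions that depend strongly on a few
    coordinates being present. *)
Lemma global_hypercontractivity c :
  prod_mean p (fun F => chaos p (noise c) F ^+ 4) <=
  \sum_U bvars p U * cnorm2 p (cderiv U c) ^+ 2.
Proof.
have := @global_hypercontractivity_on _ finset.setT unit (fun=> 1) (fun=> c) erefl.
move=> /(_ _ _); under eq_prod_mean => F do rewrite big_const card_unit /= addr0 mul1r -exprM.
move=> /(_ _ _)/le_trans -> //; first by move=> _ S; rewrite finset.subsetT.
by apply: ler_sum => U _; rewrite big_const card_unit /= addr0 mul1r.
Qed.

End Hypercontractivity.

(** * Boosters of monotone events with bounded influence *)

Section Booster.
Variables (R : realType) (T : finType) (p : T -> R).
Hypothesis p01 : forall e, 0 <= p e <= 1.
Variable A : pred {set T}.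
Hypothesis A_mono : forall F G : {set T}, F \subset G -> A F -> A G.
Implicit Types (c d : {set T} -> R) (S U F : {set T}).

Let f F : R := (A F)%:R.

(** The derivative along [U] is an alternating sum of [2 ^ #|U|] values on the subcube between
    [F :\: U] and [F :|: U]. *)
Lemma chaos_cderiv_bound c U F (M : R) :
  (forall G : {set T}, F :\: U \subset G -> G \subset F :|: U -> `|chaos p c G| <= M) ->
  `|chaos p (cderiv U c) F| <= 2 ^+ #|U| * M.
Proof.
move: {2}#|U| (erefl #|U|) => n; elim: n U c M => [|n IH] U c M cU bnd.
  have U0 : U = finset.set0 by apply/eqP; rewrite -cards_eq0 cU.
  rewrite cU expr0 mul1r.
  have -> : chaos p (cderiv U c) F = chaos p c F.
    by apply: eq_bigr => S _; rewrite U0 cderiv0.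
  by apply: bnd; rewrite U0 ?finset.setD0 ?finset.setU0.
have /card_gt0P[e eU] : (0 < #|U|)%N by rewrite cU.
have eU' : e \notin U :\ e by rewrite !inE eqxx.
have -> : chaos p (cderiv U c) F = chaos p (cderiv (U :\ e) (cderiv [set e] c)) F.
  by apply: eq_bigr => S _; rewrite -cderivU1 // finset.setD1K.
have cUe : #|U :\ e| = n by have := cardsD1 e U; rewrite cU eU => -[].
rewrite cU exprS -mulrA mulrCA -cUe; apply: IH => // G FG GF.
rewrite chaos_cderiv1 (le_trans (ler_normB _ _)) // mulr_natl mulr2n lerD //.
  apply: bnd; apply/fintype.subsetP => x.
    have := fintype.subsetP FG x; rewrite !inE.
    by case: (x == e); case: (x \in U); case: (x \in F) => //= /(_ isT) ->.
  have := fintype.subsetP GF x; rewrite !inE.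
  by case: eqP => [->|_]; rewrite ?eU ?orbT.
apply: bnd; apply/fintype.subsetP => x.
  have := fintype.subsetP FG x; rewrite !inE.
  by case: eqP => [->|_]; rewrite ?eU ?andbF.
have := fintype.subsetP GF x; rewrite !inE.
by case: (x == e); case: (x \in U); case: (x \in F) => //=.
Qed.

Lemma ind_mono F (G : {set T}) : F \subset G -> f F <= f G.
Proof. by move=> FG; rewrite ler_nat; have := A_mono FG; case: (A F) => // ->. Qed.

Lemma ind_diff01 F (G : {set T}) : F \subset G -> 0 <= f G - f F <= 1.
Proof.
move=> FG; rewrite subr_ge0 ind_mono //= /f.
by case: (A F); case: (A G); rewrite /=; lra.
Qed.

(** A monotone indicator that agrees at both ends of the subcube is constant on it, so the
    derivative vanishes unless [U] is pivotal at [F]. *)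
Lemma ind_chaos_cderiv_bound c U F : f =1 chaos p c -> U != finset.set0 ->
  `|chaos p (cderiv U c) F| <= 2 ^+ #|U| * (f (F :|: U) - f (F :\: U)).
Proof.
move=> fc /set0Pn[e eU].
have eU' : e \notin U :\ e by rewrite !inE eqxx.
have -> : chaos p (cderiv U c) F = chaos p (cderiv (U :\ e) (cderiv [set e] c)) F.
  by apply: eq_bigr => S _; rewrite -cderivU1 // finset.setD1K.
have FU : F :\: U \subset F :|: U.
  by apply/fintype.subsetP => x; rewrite !inE => /andP[_ ->].
have /andP[M0 _] := ind_diff01 FU.
apply: (@le_trans _ _ (2 ^+ #|U :\ e| * (f (F :|: U) - f (F :\: U)))).
  apply: chaos_cderiv_bound => G FG GF; rewrite chaos_cderiv1 -!fc.
  rewrite ger0_norm; last first.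
    by rewrite subr_ge0 ind_mono // (fintype.subset_trans (subsetDl _ _)) // finset.subsetUr.
  apply: lerB; apply: ind_mono; apply/fintype.subsetP => x.
    have := fintype.subsetP GF x; rewrite !inE.
    by case: eqP => [->|_] /=; rewrite ?eU ?orbT.
  have := fintype.subsetP FG x; rewrite !inE.
  by case: eqP => [->|_] /=; rewrite ?eU ?andbF.
by rewrite ler_wpM2r // ler_weXn2l ?ler1n // subset_leq_card // subsetDl.
Qed.

(** The pivotal factor is at most 1, so squaring does not increase it. This is the passage from a
    large derivative norm to the probability gained by planting [U]. *)
Lemma cnorm2_cderiv_bound c U : f =1 chaos p c -> U != finset.set0 ->
  cnorm2 p (cderiv U c) <=
  4 ^+ #|U| * prod_mean p (fun F => f (F :|: U) - f (F :\: U)).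
Proof.
move=> fc U0; rewrite -chaos_mean2 -prod_meanZ; apply: ler_prod_mean => // F.
rewrite -real_normK ?num_real //.
have FU : F :\: U \subset F :|: U.
  by apply/fintype.subsetP => x; rewrite !inE => /andP[_ ->].
have /andP[M0 M1] := ind_diff01 FU.
rewrite (le_trans (lerXn2r 2 _ _ (ind_chaos_cderiv_bound F fc U0))) ?nnegrE //.
  by rewrite mulr_ge0 // exprn_ge0.
rewrite exprMn -exprM mulnC exprM (_ : 2 ^+ 2 = 4 :> R) -?natrX //.
by rewrite ler_wpM2l ?exprn_ge0 // expr2 ler_piMr.
Qed.

Lemma cnorm2_cderiv1_ind c e : f =1 chaos p c ->
  cnorm2 p (cderiv [set e] c) = prod_mean p (fun F => f (e |: F) - f (F :\ e)).
Proof.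
move=> fc; rewrite -chaos_mean2; apply: eq_prod_mean => F.
rewrite chaos_cderiv1 -!fc /f.
have : A (F :\ e) -> A (e |: F).
  by apply: A_mono; rewrite (fintype.subset_trans (subsetDl _ _)) // finset.subsetUr.
by case: (A (F :\ e)) => [/(_ isT) ->|_]; last case: (A _);
  rewrite /= ?subrr ?subr0 ?expr0n ?expr1n.
Qed.

(** Either [|h| <= s] and the first term dominates, or [|h| > s] and [|h| <= h ^+ 4 / s ^+ 3]. *)
Lemma mul_le_quartic (u h s : R) : 0 < s -> `|u| <= 1 ->
  u * h <= s * `|u| + s^-1 ^+ 3 * h ^+ 4.
Proof.
move=> s0 u1; have h4 : h ^+ 4 = `|h| ^+ 4.
  by rewrite -normrX ger0_norm // exprn_even_ge0.
rewrite (le_trans (ler_norm _)) // normrM h4; have [hs|sh] := leP `|h| s.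
  rewrite ler_wpDr ?mulr_ge0 ?exprn_ge0 ?invr_ge0 ?(ltW s0) //.
  by rewrite mulrC ler_wpM2r.
rewrite ler_wpDl ?mulr_ge0 ?(ltW s0) //.
apply: (@le_trans _ _ `|h|); first by rewrite ler_piMl.
rewrite [X in _ * X]exprS mulrCA ler_peMr // -exprMn exprn_ege1 //.
by rewrite mulrC ler_pdivlMr // mul1r ltW.
Qed.

(** With [s = V / (4 K)] and [m] the value before the last division, [(2 s + s^-3 32^D m) K] is
    [V / 2 + V / 4 < V]. The final [4 ^+ D] is the loss between a derivative norm and a planting
    gain. *)
Definition booster_gain (K V : R) (D : nat) : R :=
  V / 4 * (V / (4 * K)) ^+ 3 / (32 ^+ D * K) / 4 ^+ D.

Lemma booster_gain_gt0 K V D : 0 < K -> 0 < V -> 0 < booster_gain K V D.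
Proof.
by move=> K0 V0; rewrite /booster_gain !(mulr_gt0, divr_gt0, exprn_gt0, invr_gt0).
Qed.

(* For [u e] the part of [f] depending on [e] and [h e] its restriction to [fam],
   [sum_e E (u e * h e)] is at least [V].  Each term is at most
   [s E |u e| + s^-3 E (h e)^4]; the first part is [2 s] times the influence as
   [f] is an indicator, the second is small by hypercontractivity unless some
   [cderiv U c] with [U] in [fam] has large norm.  Being closed under subsets,
   [fam] contains all [U] along which [h e] has a nonzero derivative. *)
Lemma booster_exists (fam : pred {set T}) (D : nat) c (K V : R) :
  f =1 chaos p c -> 0 < K -> 0 < V ->
  (forall S U, fam S -> U \subset S -> fam U) ->
  (forall S, fam S -> (#|S| <= D)%N) ->
  \sum_e bvar p e * prod_mean p (fun F => f (e |: F) - f (F :\ e)) <= K ->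
  V <= \sum_(S | fam S && (S != finset.set0)) c S ^+ 2 * bvars p S ->
  exists U, [/\ fam U, U != finset.set0 &
    booster_gain K V D <= prod_mean p (fun F => f (F :|: U) - f (F :\: U))].
Proof.
move=> fc K0 V0 famS famD infK VW.
have [/existsP[U /and3P[famU U0 bU]]|noU] := boolP [exists U, [&& fam U,
    U != finset.set0 & booster_gain K V D <= prod_mean p (fun F => f (F :|: U) - f (F :\: U))]].
  by exists U.
have [m mE] : exists m, m = V / 4 * (V / (4 * K)) ^+ 3 / (32 ^+ D * K) by eexists.
have m0 : 0 < m by rewrite mE; repeat first [apply: divr_gt0 | apply: mulr_gt0 | apply: exprn_gt0].
(* Absence of a booster caps every derivative norm along [fam] at [m]. *)
have Nm U : fam U -> U != finset.set0 -> cnorm2 p (cderiv U c) <= m.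
  move=> famU U0; rewrite (le_trans (cnorm2_cderiv_bound fc U0)) //.
  move: noU; rewrite negb_exists => /forallP/(_ U); rewrite famU U0 /= -ltNge.
  move=> /ltW lt_gain; apply: (@le_trans _ _ (4 ^+ #|U| * booster_gain K V D)).
    by rewrite ler_wpM2l ?exprn_ge0.
  rewrite (@le_trans _ _ (4 ^+ D * booster_gain K V D)) //.
    by rewrite ler_wpM2r ?(ltW (booster_gain_gt0 _ _ _)) // ler_weXn2l ?ler1n ?famD.
  by rewrite /booster_gain -mE mulrCA divff ?mulr1 // gt_eqF // exprn_gt0.
have v0 := bvar_ge0 p01; have vs0 := bvars_ge0 p01.
have v1 e : bvar p e <= 1.
  by have /andP[p0 p1] := p01 e; rewrite /bvar mulr_ile1 ?subr_ge0 // gerBl.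
pose W S := c S ^+ 2 * bvars p S.
have W0 S : 0 <= W S by rewrite mulr_ge0 ?sqr_ge0.
pose h e S := if (e \in S) && fam S then c S else 0.
(* The factor undoes the noise, so that hypercontractivity bounds [h e] itself; on [fam] it is at
   most [2 ^+ D]. *)
pose g e S := 2 ^+ #|S| * h e S.
pose u e S := if e \in S then c S else 0.
have gh e F : chaos p (noise (g e)) F = chaos p (h e) F.
  apply: eq_bigr => S _; rewrite /noise /g mulrA -exprMn mulVf ?expr1n ?mul1r //.
pose gain e := bvar p e * prod_mean p (fun F => f (e |: F) - f (F :\ e)).
have sumW e : \sum_(S : {set T} | e \in S) W S = gain e.
  rewrite /gain -(cnorm2_cderiv1_ind _ fc) -[bvar p e](_ : bvars p [set e] = _); last first.
    by rewrite /bvars big_set1.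
  by rewrite cnorm2_cderiv; apply: eq_bigl => S; rewrite sub1set.
have uE e F : chaos p (u e) F = centered p e F * (f (e |: F) - f (F :\ e)).
  rewrite (chaos_split _ e) /chaos big1 ?add0r => [|S _]; last first.
    by rewrite /cavg /u; case: (e \in S); rewrite mul0r.
  rewrite 2!fc -chaos_cderiv1; congr (_ * _); apply: eq_bigr => S _.
  by rewrite !cderiv1E /u setU11.
have u1 e F : `|chaos p (u e) F| <= 1.
  rewrite uE normrM mulr_ile1 ?normr_ge0 //.
    have /andP[p0 p1] := p01 e; rewrite /centered ler_norml.
    by case: (e \in F) => /=; lra.
  have /ind_diff01/andP[d0 d1] : F :\ e \subset e |: F.
    by rewrite (fintype.subset_trans (subsetDl _ _)) // finset.subsetUr.
  by rewrite ger0_norm.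
have uL1 e : prod_mean p (fun F => `|chaos p (u e) F|) = 2 * gain e.
  rewrite /gain -!prod_meanZ (prod_mean_avg _ e) [RHS](prod_mean_avg _ e).
  apply: eq_prod_mean => F; rewrite !uE.
  have dU (F' : {set T}) : (forall x, x != e -> (x \in F') = (x \in F)) ->
      (e |: F' = e |: F) * (F' :\ e = F :\ e).
    move=> F'F; split; apply/setP => x; rewrite !inE; by case: eqP => //= /eqP /F'F.
  rewrite !(dU (e |: F)); try by move=> x xe; rewrite !inE (negPf xe).
  rewrite !(dU (F :\ e)); try by move=> x xe; rewrite !inE xe.
  have /ind_diff01/andP[d0 _] : F :\ e \subset e |: F.
    by rewrite (fintype.subset_trans (subsetDl _ _)) // finset.subsetUr.
  rewrite !normrM (ger0_norm d0) /centered !inE eqxx /=.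
  have /andP[p0 p1] := p01 e.
  rewrite ger0_norm ?subr_ge0 // sub0r normrN ger0_norm // /bvar; ring.
have uh e : prod_mean p (fun F => chaos p (u e) F * chaos p (h e) F) =
    \sum_(S : {set T} | (e \in S) && fam S) W S.
  rewrite chaos_mean [RHS]big_mkcond; apply: eq_bigr => S _.
  by rewrite /u /h /W; case: (e \in S); case: (fam S); rewrite /= ?(mul0r, mulr0) // expr2.
have Ng U e : cnorm2 p (cderiv U (g e)) <= 4 ^+ D * m.
  have Ng' U' : e \in U' -> cnorm2 p (cderiv U' (g e)) <= 4 ^+ D * m.
    move=> eU'; have [famU'|nfam] := boolP (fam U'); last first.
      rewrite [leLHS]big1  => [|S _]; [by rewrite mulr_ge0 ?exprn_ge0 ?(ltW m0)|].
      rewrite /cderiv /g /h; case: ifP => _; last by rewrite expr0n mul0r.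
      case: ifP => [/andP[_ /famS]|_]; last by rewrite mulr0 expr0n mul0r.
      by move=> /(_ U' (finset.subsetUr _ _)); rewrite (negPf nfam).
    have U'0 : U' != finset.set0 by apply/set0Pn; exists e.
    apply: le_trans (ler_wpM2l (exprn_ge0 _ _) (Nm _ famU' U'0)) => //.
    rewrite /cnorm2 mulr_sumr; apply: ler_sum => S _; rewrite mulrA ler_wpM2r //.
    rewrite /cderiv; case: ifP => _; last by rewrite expr0n mulr0.
    rewrite /g /h; case: ifP => [/andP[_ /famD SD]|_]; last first.
      by rewrite mulr0 expr0n mulr_ge0 ?sqr_ge0 // exprn_ge0.
    rewrite exprMn ler_wpM2r ?sqr_ge0 // -exprM mulnC exprM -natrX.
    by rewrite ler_weXn2l ?ler1n.
  (* All coefficients of [g e] sit on sets containing [e], so averaging [e] out leaves nothing and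
     [U] may be enlarged by [e]. *)
  have [/Ng'//|eU] := boolP (e \in U).
  rewrite (cnorm2_cderiv_split p _ eU) [X in X + _]big1 ?add0r => [|S _]; last first.
    rewrite /cderiv /cavg /g /h; case: ifP => _; last by rewrite expr0n mul0r.
    by case: (e \in _) => /=; rewrite ?mulr0 expr0n mul0r.
  rewrite -[leRHS]mul1r ler_pM ?cnorm2_ge0 //.
  rewrite -(eq_cnorm2 p (cderivU1 (g e) eU)); apply: Ng'; exact: setU11.
have h4 e : prod_mean p (fun F => chaos p (h e) F ^+ 4) <= 32 ^+ D * m * gain e.
  under eq_prod_mean => F do rewrite -gh.
  apply: le_trans (global_hypercontractivity p01 _) _.
  apply: (@le_trans _ _ (\sum_U 4 ^+ D * m * (bvars p U * cnorm2 p (cderiv U (g e))))).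
    apply: ler_sum => U _; rewrite expr2 mulrCA ler_wpM2r ?mulr_ge0 ?cnorm2_ge0 //.
  rewrite -mulr_sumr.
  under eq_bigr => U _ do rewrite cnorm2_cderiv big_mkcond.
  rewrite exchange_big /=.
  (* The factor [4 ^+ D] comes from [Ng]; [8 ^+ D] collects the [2 ^ #|S|] subsets of [S] and the
     [4 ^ #|S|] from squaring [g e]. *)
  rewrite (_ : 32 = 4 * 8); last by rewrite -natrM.
  rewrite exprMn -!mulrA ler_wpM2l ?exprn_ge0 // mulrCA ler_wpM2l ?(ltW m0) //.
  rewrite -sumW [X in _ <= _ * X]big_mkcond mulr_sumr; apply: ler_sum => S _.
  rewrite -big_mkcond /= sumr_const.
  have -> : #|[pred U : {set T} | U \subset S]| = (2 ^ #|S|)%N.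
    by rewrite -card_powerset; apply: eq_card => U; rewrite !inE.
  rewrite /g /h; case: (boolP (_ && _)) => /= [/andP[eS /famD SD]|_]; last first.
    rewrite mulr0 expr0n mul0r mul0rn; case: (e \in S); last by rewrite mulr0.
    by rewrite mulr_ge0 ?exprn_ge0.
  rewrite eS exprMn -[_ *+ (2 ^ _)]mulr_natl /W mulrA [leRHS]mulrA ler_wpM2r //.
  rewrite mulrA ler_wpM2r ?sqr_ge0 //.
  rewrite natrX -exprM mulnC exprM -exprMn (_ : 2 * 2 ^+ 2 = 8 :> R); last by ring.
  by rewrite ler_weXn2l ?ler1n.
have [s sE] : exists s, s = V / (4 * K) by eexists.
have s0 : 0 < s by rewrite sE divr_gt0 ?mulr_gt0.
have step e : \sum_(S : {set T} | (e \in S) && fam S) W S <=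
    (2 * s + s^-1 ^+ 3 * (32 ^+ D * m)) * gain e.
  rewrite -uh; apply: (@le_trans _ _ (s * prod_mean p (fun F => `|chaos p (u e) F|)
      + s^-1 ^+ 3 * prod_mean p (fun F => chaos p (h e) F ^+ 4))).
    rewrite -!prod_meanZ -prod_meanD; apply: ler_prod_mean => // F.
    exact: mul_le_quartic.
  rewrite uL1 [leRHS](_ : _ =
    s * (2 * gain e) + s^-1 ^+ 3 * (32 ^+ D * m * gain e)); last by ring.
  rewrite lerD2l ler_wpM2l ?h4 //.
  by rewrite exprn_ge0 // invr_ge0 ltW.
have : V <= (2 * s + s^-1 ^+ 3 * (32 ^+ D * m)) * K.
  apply: le_trans (_ : (2 * s + s^-1 ^+ 3 * (32 ^+ D * m)) * \sum_e gain e <= _); last first.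
    by rewrite ler_wpM2l // addr_ge0 ?mulr_ge0 ?exprn_ge0 ?invr_ge0 ?(ltW s0) ?(ltW m0).
  apply: le_trans VW _; rewrite mulr_sumr.
  apply: le_trans (_ : \sum_e \sum_(S : {set T} | (e \in S) && fam S) W S <= _); last first.
    by apply: ler_sum => e _; apply: step.
  under [leRHS]eq_bigr => e _ do rewrite big_mkcond.
  rewrite exchange_big big_mkcond; apply: ler_sum => S _ /=.
  case: ifP => [/andP[famS' /set0Pn[e eS]]|_]; last first.
    by apply: sumr_ge0 => e _; case: ifP.
  rewrite (bigD1 e) //= eS famS' /= ler_wpDr //.
  by apply: sumr_ge0 => x _; case: ifP.
rewrite (_ : _ * K = 3 / 4 * V); first by move: V0; lra.
rewrite mE sE; field.
by rewrite !gt_eqF ?exprn_gt0.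
Qed.

End Booster.

(** * Hall's theorem and satisfiability *)

(** Halmos-Vaughan induction: if a proper nonempty subset is tight, match it, then match the rest
    outside its neighbourhood; otherwise any single choice preserves Hall's condition. *)
Lemma hall_matching (T V : finType) (v0 : V) (N : T -> {set V}) (S : {set T}) :
  (forall B : {set T}, B \subset S -> (#|B| <= #|\bigcup_(a in B) N a|)%N) ->
  exists m : T -> V, {in S &, injective m} /\ {in S, forall a, m a \in N a}.
Proof.
move: {2}#|S| (leqnn #|S|) => n; elim: n N S => [|n IH] N S cS hallS.
  move: cS; rewrite leqn0 cards_eq0 => /eqP ->.
  by exists (fun=> v0); split=> [a b|a]; rewrite inE.
have [S0|/set0Pn[a aS]] := eqVneq S finset.set0.
  by rewrite S0; exists (fun=> v0); split=> [a b|a]; rewrite inE.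
have [/existsP[B /and3P[BS B0 Btight]]|notight] := boolP [exists B : {set T},
    [&& B \proper S, B != finset.set0 & #|\bigcup_(x in B) N x| <= #|B|]%N].
  have cB : (#|B| < #|S|)%N by apply: proper_card.
  have [|x xB|m1 [m1i m1N]] := IH N B; [by lia | | ].
    by apply: hallS; rewrite (fintype.subset_trans xB) // proper_sub.
  pose NB := \bigcup_(x in B) N x.
  have cSB : (#|S :\: B| <= n)%N.
    rewrite cardsD (finset.setIidPr _) ?proper_sub //.
    by have : (0 < #|B|)%N; [rewrite card_gt0 | lia].
  have [|m2 [m2i m2N]] := IH (fun x => N x :\: NB) (S :\: B) cSB.
    move=> C CS.
    have CB : [disjoint C & B].
      rewrite disjoints_subset; apply/fintype.subsetP => x /(fintype.subsetP CS).
      by rewrite !inE => /andP[].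
    have := hallS (C :|: B); rewrite finset.subUset (proper_sub BS).
    rewrite (fintype.subset_trans CS (subsetDl _ _)) => /(_ isT).
    rewrite cardsU disjoint_setI0 // cards0 subn0.
    have -> : \bigcup_(x in C :|: B) N x = (\bigcup_(x in C) (N x :\: NB)) :|: NB.
      apply/setP => v; rewrite !inE; apply/bigcupP/orP => [[x]|].
        have [vNB _ _|vNB] := boolP (v \in NB); first by right.
        rewrite inE => /orP[xC xv|xB xv]; left; first by apply/bigcupP; exists x; rewrite // inE vNB.
        by case/negP: vNB; apply/bigcupP; exists x.
      move=> [/bigcupP[x xC]|/bigcupP[x xB xv]]; last by exists x; rewrite // inE xB orbT.
      by rewrite inE => /andP[_ xv]; exists x; rewrite // inE xC.
    rewrite cardsU => /leq_trans /(_ (leq_subr _ _)) => CBle.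
    by move: Btight; rewrite -/NB; lia.
  exists (fun x => if x \in B then m1 x else m2 x); split=> [x y xS yS|x xS]; last first.
    case: ifPn => xB; first exact: m1N.
    by have := m2N x; rewrite !inE xB xS => /(_ isT)/andP[].
  case: ifPn => xB; case: ifPn => yB.
  - exact: m1i.
  - move=> xy; have := m2N y; rewrite !inE yB yS => /(_ isT)/andP[/negP[]].
    by rewrite -xy; apply/bigcupP; exists x; rewrite // m1N.
  - move=> xy; have := m2N x; rewrite !inE xB xS => /(_ isT)/andP[/negP[]].
    by rewrite xy; apply/bigcupP; exists y; rewrite // m1N.
  - by apply: m2i; rewrite inE ?xB ?yB.
have [v vN] : exists v, v \in N a.
  have := hallS [set a]; rewrite sub1set aS big_set1 cards1 => /(_ isT).
  by move=> /card_gt0P.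
have cSa : (#|S :\ a| <= n)%N by move: cS; rewrite (cardsD1 a) aS.
have [|m [mi mN]] := IH (fun x => N x :\ v) (S :\ a) cSa.
  move=> C CS; have [->|C0] := eqVneq C finset.set0; first by rewrite cards0.
  have CpS : C \proper S.
    by apply: sub_proper_trans CS _; rewrite properD1.
  move: notight; rewrite negb_exists => /forallP/(_ C); rewrite CpS C0 /= -ltnNge.
  have -> : \bigcup_(x in C) (N x :\ v) = (\bigcup_(x in C) N x) :\ v.
    apply/setP => w; rewrite !inE; apply/bigcupP/andP => [[x xC]|[wv /bigcupP[x xC xw]]].
      by rewrite !inE => /andP[-> xw]; split=> //; apply/bigcupP; exists x.
    by exists x; rewrite // !inE wv.
  by rewrite (cardsD1 v (\bigcup_(x in C) N x)); case: (v \in _); lia.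
exists (fun x => if x == a then v else m x).
have mNv x : x \in S -> x != a -> (m x != v) && (m x \in N x).
  by move=> xS xa; have := mN x; rewrite !inE xa xS => /(_ isT).
split=> [x y xS yS|x xS]; last first.
  by case: eqVneq => [->//|xa]; case/andP: (mNv x xS xa).
case: eqVneq => [->|xa]; case: eqVneq => [->//|ya].
- by move=> vm; case/andP: (mNv y yS ya); rewrite -vm eqxx.
- by move=> mv; case/andP: (mNv x xS xa); rewrite mv eqxx.
- by apply: mi; rewrite !inE ?xa ?ya.
Qed.

Definition clause_vars n (c : clause n) : {set 'I_n} := [set l.1 | l in c].

(** Hall's theorem gives each clause a variable of its own, which is set so as to satisfy that
    clause; injectivity keeps these choices from clashing. *)
Lemma hall_satisfiable n (S : {set clause n}) : (0 < n)%N ->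
  (forall B : {set clause n}, B \subset S ->
     (#|B| <= #|\bigcup_(c in B) clause_vars c|)%N) ->
  exists (X : {set 'I_n}) (s : assignment n), (#|X| <= #|S|)%N /\
    forall c : clause n, c \in S ->
      exists l : literal n, [/\ l \in c, l.1 \in X & s l.1 = l.2].
Proof.
move=> n0 /(hall_matching (Ordinal n0))[m [mi mN]].
exists (m @: S), [ffun v => [exists c in S, (m c == v) && ((v, true) \in c)]].
split=> [|c cS]; first exact: leq_imset_card.
have [mc|mc] := boolP ((m c, true) \in c).
  exists (m c, true); split; rewrite //= ?imset_f // ffunE.
  by apply/exists_inP; exists c; rewrite // eqxx.
exists (m c, false); split=> /=; rewrite ?imset_f //.
  have /imsetP[[v [|]] vc mE] := mN c cS; rewrite {}mE //= in mc *.
  by rewrite vc in mc.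
rewrite ffunE; apply/negbTE/exists_inP => -[c' c'S /andP[/eqP mcc']].
by rewrite (mi _ _ c'S cS mcc') (negPf mc).
Qed.

(** * Replacing random literals by random clauses *)

Definition avg (R : realType) (I : finType) (h : I -> R) : R :=
  (\sum_i h i) / #|I|%:R.

Section Average.
Variables (R : realType) (I : finType).
Implicit Types h : I -> R.

Lemma eq_avg h h' : h =1 h' -> avg h = avg h'.
Proof. by move=> hh'; rewrite /avg (eq_bigr _ (fun i _ => hh' i)). Qed.

Lemma ler_avg h h' : (forall i, h i <= h' i) -> avg h <= avg h'.
Proof. by move=> hh'; rewrite ler_wpM2r ?invr_ge0 // ler_sum. Qed.

Lemma avg_ge0 h : (forall i, 0 <= h i) -> 0 <= avg h.
Proof. by move=> h0; rewrite divr_ge0 // sumr_ge0. Qed.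

Lemma avg_cst (a : R) : (0 < #|I|)%N -> avg (fun _ : I => a) = a.
Proof.
move=> I0; rewrite /avg sumr_const -[_ *+ _]mulr_natr mulfK //.
by rewrite pnatr_eq0 -lt0n.
Qed.

Lemma avgZ a h : avg (fun i => a * h i) = a * avg h.
Proof. by rewrite /avg -mulr_sumr mulrA. Qed.

Lemma avgD h h' : avg (fun i => h i + h' i) = avg h + avg h'.
Proof. by rewrite /avg big_split mulrDl. Qed.

Lemma avg_sum (J : Type) (s : seq J) (P : pred J) (h : J -> I -> R) :
  avg (fun i => \sum_(j <- s | P j) h j i) = \sum_(j <- s | P j) avg (h j).
Proof. by rewrite /avg exchange_big mulr_suml. Qed.

Lemma power_tangent (x m : R) k : 0 <= x -> 0 <= m ->
  m ^+ k.+1 + k.+1%:R * m ^+ k * (x - m) <= x ^+ k.+1.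
Proof.
move=> x0 m0; elim: k => [|k IH]; first by rewrite !expr1 expr0 !mul1r addrC subrK.
rewrite [leRHS]exprS; apply: le_trans (ler_wpM2l x0 IH).
rewrite -subr_ge0 [leRHS](_ : _ = k.+1%:R * m ^+ k * (x - m) ^+ 2).
  by rewrite mulr_ge0 ?sqr_ge0 // mulr_ge0 ?exprn_ge0.
by rewrite !exprS -[k.+2%:R]natr1; ring.
Qed.

Lemma avg_jensen h k : (0 < #|I|)%N -> (forall i, 0 <= h i) ->
  avg h ^+ k <= avg (fun i => h i ^+ k).
Proof.
move=> I0 h0; case: k => [|k]; first by rewrite avg_cst ?expr0.
have m0 := avg_ge0 h0; set m := avg h in m0 *.
apply: (@le_trans _ _ (avg (fun i => m ^+ k.+1 + k.+1%:R * m ^+ k * (h i + - m)))).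
  by rewrite avgD avgZ avgD !avg_cst // -/m subrr mulr0 addr0.
by apply: ler_avg => i; apply: power_tangent.
Qed.

Lemma avg_prod k h :
  avg (fun t : {ffun 'I_k -> I} => \prod_i h (t i)) = avg h ^+ k.
Proof.
rewrite /avg exprMn exprVn card_ffun card_ord natrX; congr (_ / _).
rewrite -(bigA_distr_bigA (fun=> h)) /=.
by rewrite prodr_const card_ord.
Qed.

Lemma avg_swap (J : finType) (h : I -> J -> R) :
  avg (fun i => avg (h i)) = avg (fun j => avg (h^~ j)).
Proof.
rewrite /avg -!mulr_suml exchange_big -!mulrA; congr (_ * _); exact: mulrC.
Qed.

End Average.

(** The [r] draws are independent and may repeat; the recursive form lets inductions handle one draw
    at a time. *)
Fixpoint avg_cut (R : realType) (A I : finType) (g : I -> {set A}) (r : nat)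
    (h : {set A} -> R) (X : {set A}) : R :=
  if r is r'.+1 then avg (fun i => avg_cut g r' h (X :&: g i)) else h X.

Section AverageCut.
Variables (R : realType) (A I : finType) (g : I -> {set A}).
Hypothesis I0 : (0 < #|I|)%N.
Implicit Types (h : {set A} -> R) (X Y : {set A}).

Lemma avg_cutD r r' h X : avg_cut g (r + r') h X = avg_cut g r (avg_cut g r' h) X.
Proof. by elim: r X => //= r IH X; apply: eq_avg => i; rewrite IH. Qed.

Lemma ler_avg_cut r h h' X : (forall Y, h Y <= h' Y) ->
  avg_cut g r h X <= avg_cut g r h' X.
Proof. by move=> hh'; elim: r X => //= r IH X; apply: ler_avg. Qed.

Lemma avg_cut_cst r (a : R) X : avg_cut g r (fun=> a) X = a.
Proof.
by elim: r X => //= r IH X; under eq_avg => i do rewrite IH; rewrite avg_cst.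
Qed.

Lemma avg_cutZ r a h X : avg_cut g r (fun Y => a * h Y) X = a * avg_cut g r h X.
Proof.
by elim: r X => //= r IH X; under eq_avg => i do rewrite IH; rewrite avgZ.
Qed.

Lemma avg_cutDr r h h' X :
  avg_cut g r (fun Y => h Y + h' Y) X = avg_cut g r h X + avg_cut g r h' X.
Proof.
by elim: r X => //= r IH X; under eq_avg => i do rewrite IH; rewrite avgD.
Qed.

Lemma avg_cut_ge0 r h X : (forall Y, 0 <= h Y) -> 0 <= avg_cut g r h X.
Proof. by move=> h0; rewrite -[leLHS](avg_cut_cst r 0 X) ler_avg_cut. Qed.

Lemma avg_cut_jensen r h k X : (forall Y, 0 <= h Y) ->
  avg_cut g r h X ^+ k <= avg_cut g r (fun Y => h Y ^+ k) X.
Proof.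
move=> h0; elim: r X => //= r IH X.
apply: (le_trans (avg_jensen _ I0 _)); last by apply: ler_avg.
by move=> i; apply: avg_cut_ge0.
Qed.

Lemma avg_cut_antitone r h X Y :
  (forall X Y, X \subset Y -> h Y <= h X) ->
  X \subset Y -> avg_cut g r h Y <= avg_cut g r h X.
Proof.
move=> ha; elim: r X Y => [|r IH] X Y XY /=; first exact: ha.
by apply: ler_avg => i; apply: IH; apply: finset.setSI.
Qed.

Lemma avg_cut_swap (J : finType) (f : J -> {set A}) r h X :
  avg (fun j => avg_cut g r h (X :&: f j)) =
  avg_cut g r (fun Y => avg (fun j => h (Y :&: f j))) X.
Proof.
elim: r X => //= r IH X; rewrite avg_swap; apply: eq_avg => i.
by rewrite -IH; apply: eq_avg => j; rewrite finset.setIAC.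
Qed.

End AverageCut.

Definition few (R : realType) (A : finType) (theta : R) (X : {set A}) : R :=
  (#|X|%:R < theta)%R%:R.

Section BlowUp.
Variables (R : realType) (A I : finType) (g : I -> {set A}) (k : nat).
Hypothesis I0 : (0 < #|I|)%N.
Hypothesis k0 : (0 < k)%N.
Implicit Types (X Y : {set A}) (theta : R).

(** For [g] equal to [lit_sols], these are the assignments satisfying the disjunction of the
    literals of [t]. *)
Definition tuple_cup (t : {ffun 'I_k -> I}) : {set A} := \bigcup_i g (t i).

Lemma few01 theta X : 0 <= few theta X <= 1.
Proof. by rewrite /few; case: (_ < _); rewrite /= ?lexx ?ler01. Qed.

Lemma few_ge0 theta X : 0 <= few theta X.
Proof. by case/andP: (few01 theta X). Qed.

Lemma few_antitone theta X Y : X \subset Y -> few theta Y <= few theta X.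
Proof.
move=> /subset_leq_card XY; rewrite /few ler_nat.
have [Yt|] := ltP _ theta; last by case: (_ < _).
by rewrite (le_lt_trans _ Yt) // ler_nat.
Qed.

Lemma card_tuples_gt0 : (0 < #|{ffun 'I_k -> I}|)%N.
Proof. by rewrite card_ffun expn_gt0 I0. Qed.

(** A union of [k] pieces with fewer than [theta] points each has fewer than [k * theta], and
    independence of the [k] draws produces the [k]-th power. *)
Lemma few_blowup1 theta Y :
  avg (fun i => few theta (Y :&: g i)) ^+ k <=
  avg (fun t => few (k%:R * theta) (Y :&: tuple_cup t)).
Proof.
rewrite -avg_prod; apply: ler_avg => t.
have [/forallP small|] := boolP [forall i, #|Y :&: g (t i)|%:R < theta].
  rewrite big1 => [|i _]; last by rewrite /few small.
  rewrite /few ler1n lt0b.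
  apply: le_lt_trans (_ : (\sum_i #|Y :&: g (t i)|)%:R < _); last first.
    rewrite natr_sum [ltRHS](_ : _ = \sum_(i < k) theta); last first.
      by rewrite sumr_const card_ord mulr_natl.
    apply: ltr_sum => //.
    by apply/hasP; exists (Ordinal k0); rewrite ?mem_index_enum.
  rewrite ler_nat /tuple_cup.
  apply: (big_ind2 (fun (B : {set A}) n => #|Y :&: B| <= n)%N) => //.
    by rewrite finset.setI0 cards0.
  move=> B n B' n' Bn B'n'; rewrite finset.setIUr.
  by rewrite (leq_trans (leq_card_setU _ _)) // leq_add.
by rewrite negb_forall => /existsP[i ti]; rewrite (bigD1 i) //= {1}/few (negPf ti) mul0r few_ge0.
Qed.

(* If all [k^r] choices of one element in each of [r] tuples leave fewer than
   [theta] points, their union has fewer than [k^r * theta]; Jensen's inequality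
   bounds the probability that this happens. *)
Lemma few_blowup r theta X :
  avg_cut g r (few theta) X ^+ (k ^ r) <=
  avg_cut tuple_cup r (few ((k ^ r)%:R * theta)) X.
Proof.
have T0 := card_tuples_gt0.
elim: r X => [|r IH] X; first by rewrite expn0 expr1 mul1r.
have -> h : avg_cut tuple_cup r.+1 h X = avg_cut tuple_cup r (avg_cut tuple_cup 1 h) X.
  by rewrite -avg_cutD addn1.
apply: (@le_trans _ _ (avg_cut tuple_cup r (fun Y =>
    avg (fun i => few ((k ^ r)%:R * theta) (Y :&: g i)) ^+ k) X)); last first.
  apply: ler_avg_cut => Y; apply: le_trans (few_blowup1 _ _) _.
  by rewrite mulrA -natrM -expnS.
pose h Y := avg (fun i => few ((k ^ r)%:R * theta) (Y :&: g i)).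
have h0 Y : 0 <= h Y by apply: avg_ge0 => i; apply: few_ge0.
have J := avg_cut_jensen tuple_cup T0 r k X h0.
apply: le_trans J.
rewrite expnS mulnC exprM lerXn2r ?nnegrE ?exprn_ge0 //.
- by apply: avg_ge0 => i; apply: avg_cut_ge0 => // Y; apply: few_ge0.
- by apply: avg_cut_ge0 => // Y; apply: avg_ge0 => i; apply: few_ge0.
rewrite -avg_cut_swap; apply: le_trans (avg_jensen _ I0 _) _.
  by move=> i; apply: avg_cut_ge0 => // Y; apply: few_ge0.
by apply: ler_avg => i.
Qed.

Hypothesis g_half : forall s, avg (fun i => (s \in g i)%:R : R) = 1 / 2.

Lemma avg_tuple_mem s :
  avg (fun t => (s \in tuple_cup t)%:R : R) = 1 - 2^-1 ^+ k.
Proof.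
have half : avg (fun i => (s \notin g i)%:R : R) = 2^-1.
  apply: (addrI (avg (fun i => (s \in g i)%:R : R))); rewrite -avgD g_half.
  under eq_avg => i do rewrite -natrD addnC addn_negb.
  by rewrite avg_cst //; field.
rewrite -half -avg_prod.
apply: (@addIr _ (avg (fun t : {ffun 'I_k -> I} => \prod_i (s \notin g (t i))%:R))).
rewrite subrK -avgD -[RHS](avg_cst _ card_tuples_gt0); apply: eq_avg => t.
have [/bigcupP[i _ si]|/bigcupP nsi] := boolP (s \in _).
  by rewrite (bigD1 i) //= si mul0r addr0.
rewrite big1 ?add0r // => i _; case: (boolP (s \in g (t i))) => // si.
by case: nsi; exists i.
Qed.

Lemma avg_cut_card m X :
  avg_cut tuple_cup m (fun Y => #|Y|%:R : R) X = (1 - 2^-1 ^+ k) ^+ m * #|X|%:R.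
Proof.
elim: m X => [|m IH] X /=; first by rewrite expr0 mul1r.
under eq_avg => t do rewrite IH; rewrite avgZ exprSr -mulrA; congr (_ * _).
transitivity (avg (fun t => \sum_(s in X) (s \in tuple_cup t)%:R : R)).
  apply: eq_avg => t; rewrite -sum1_card natr_sum big_mkcond [RHS]big_mkcond.
  by apply: eq_bigr => s _; rewrite inE; case: (s \in X); case: (s \in _).
rewrite avg_sum; under eq_bigr => s _ do rewrite avg_tuple_mem.
by rewrite sumr_const mulr_natr.
Qed.

(* Each random tuple multiplies the mean of [#|X|] by [1 - 2^-k]: Markov. *)
Lemma few_slack m theta (M : R) X : 0 < theta -> 0 <= M ->
  (1 - 2^-1 ^+ k) ^+ m * M <= 1 / 2 ->
  few (M * theta) X / 2 <= avg_cut tuple_cup m (few theta) X.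
Proof.
move=> th0 M0 mM; have T0 := card_tuples_gt0.
have [XM|XM] := ltP #|X|%:R (M * theta); last first.
  rewrite {1}/few ltNge XM mul0r; apply: avg_cut_ge0 => // Y; exact: few_ge0.
rewrite {1}/few XM.
(* A linear minorant of [few] with explicit mean: at most 1 everywhere, and nonpositive once
   [#|Y| >= theta]. *)
apply: (@le_trans _ _ (avg_cut tuple_cup m (fun Y => 1 + - theta^-1 * #|Y|%:R) X)).
  rewrite avg_cutDr avg_cut_cst // avg_cutZ avg_cut_card mulNr.
  rewrite (le_trans _ (_ : 1 - (1 - 2^-1 ^+ k) ^+ m * M <= _)) //.
    by move: mM; rewrite /=; lra.
  rewrite lerD2l lerN2 mulrCA ler_wpM2l //.
    by rewrite exprn_ge0 // subr_ge0 exprn_ile1 // invf_le1 ?ler1n.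
  by rewrite mulrC ler_pdivrMr // ltW.
apply: ler_avg_cut => Y; rewrite /few mulNr mulrC.
have [_|Yt] := ltP #|Y|%:R theta; first by rewrite ?Yt gerBl divr_ge0 // ltW.
by rewrite subr_le0 ler_pdivlMr // mul1r.
Qed.

(** The last [r] draws' worth of blow-up is absorbed by [m] additional tuples: level [k ^ r * theta]
    is brought down to [theta] at the price of a factor 2. *)
Lemma few_blowup_slack r m theta X : 0 < theta ->
  (1 - 2^-1 ^+ k) ^+ m * (k ^ r)%:R <= 1 / 2 :> R ->
  avg_cut g r (few theta) X ^+ (k ^ r) / 2 <=
  avg_cut tuple_cup (r + m) (few theta) X.
Proof.
move=> th0 mr; rewrite avg_cutD mulrC.
apply: le_trans (ler_wpM2l _ (few_blowup _ _ _)) _; first by rewrite invr_ge0.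
rewrite -avg_cutZ; apply: ler_avg_cut => Y; rewrite mulrC.
by apply: few_slack.
Qed.

End BlowUp.

(** * Random formulas *)

Lemma prod_mean_perm (R : comNzRingType) (T : finType) (p : T -> R) (h : T -> T) f :
  injective h -> (forall e, p (h e) = p e) ->
  prod_mean p f = prod_mean p (fun F => f (h @: F)).
Proof.
move=> hi ph; rewrite /prod_mean (reindex_inj (imset_inj hi)) /=.
apply: eq_bigr => F _; congr (_ * _); rewrite /prod_weight (reindex_inj hi) /=.
by apply: eq_bigr => e _; rewrite (mem_imset _ _ hi) ph.
Qed.

Lemma few_le_avg_cut (R : realType) (A I : finType) (g : I -> {set A}) r
    (theta : R) (X Y : {set A}) : (0 < #|I|)%N ->
  X \subset Y -> few theta Y <= avg_cut g r (few theta) X.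
Proof.
move=> I0; elim: r X => [|r IH] X XY /=; first exact: few_antitone.
rewrite -[leLHS](@avg_cst R I) //; apply: ler_avg => i; apply: IH.
by apply: fintype.subset_trans XY; apply: finset.subsetIl.
Qed.

Section Formulas.
Variable n : nat.
Implicit Types (F G : cnf n) (c : clause n) (s : assignment n) (l : literal n).

Definition sols F : {set assignment n} := [set s : assignment n | sat_cnf s F].

Definition lit_sols l : {set assignment n} := [set s : assignment n | s l.1 == l.2].

Definition cube (t : seq (literal n)) : {set assignment n} :=
  [set s : assignment n | all (fun l => s l.1 == l.2) t].

Lemma nb_satE F : nb_sat F = #|sols F|.
Proof. by rewrite /nb_sat /sols cardsE. Qed.

Lemma solsU (F G : {set clause n}) : sols (F :|: G) = sols F :&: sols G.
Proof.
apply/setP => s; rewrite !inE; apply/forall_inP/andP => [sat|[/forall_inP sF /forall_inP sG] c].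
  by split; apply/forall_inP => c cF; apply: sat; rewrite inE cF ?orbT.
by rewrite inE => /orP[/sF|/sG].
Qed.

Lemma sols_antitone (F G : {set clause n}) : F \subset G -> sols G \subset sols F.
Proof. by move=> /finset.setUidPr <-; rewrite solsU finset.subsetIl. Qed.

Lemma cube_cons l t : cube (l :: t) = lit_sols l :&: cube t.
Proof. by apply/setP => s; rewrite !inE. Qed.

Definition signed_perm (pi : {perm 'I_n}) (b : {ffun 'I_n -> bool}) l : literal n :=
  (pi l.1, l.2 (+) b l.1).

Definition signed_perm_assignment (pi : {perm 'I_n}) (b : {ffun 'I_n -> bool}) s
  : assignment n := [ffun v => s (pi^-1%g v) (+) b (pi^-1%g v)].

Definition signed_perm_clause pi b c : clause n := signed_perm pi b @: c.

Lemma signed_perm_inj pi b : injective (signed_perm pi b).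
Proof. by move=> [v x] [w y] [/perm_inj -> /addIb ->]. Qed.

Lemma signed_perm_assignment_inj pi b : injective (signed_perm_assignment pi b).
Proof.
move=> s s' /ffunP ss'; apply/ffunP => v; have := ss' (pi v).
by rewrite !ffunE permK => /addIb.
Qed.

Lemma signed_perm_sat pi b s l :
  (signed_perm_assignment pi b s (signed_perm pi b l).1 == (signed_perm pi b l).2)
  = (s l.1 == l.2).
Proof. by rewrite ffunE permK /= (inj_eq (@addIb _)). Qed.

Lemma signed_perm_kclauses k pi b c :
  (signed_perm_clause pi b c \in kclauses n k) = (c \in kclauses n k).
Proof.
rewrite !inE /is_kclause card_imset; last exact: signed_perm_inj.
congr (_ && (_ == _)).
rewrite -[RHS](card_imset _ (@perm_inj _ pi)); congr #|pred_of_set _|.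
by rewrite -!imset_comp.
Qed.

Lemma sols_signed_perm pi b F t :
  #|sols (signed_perm_clause pi b @: F) :&: cube (map (signed_perm pi b) t)| =
  #|sols F :&: cube t|.
Proof.
rewrite -(card_preimset _ (@signed_perm_assignment_inj pi b)).
congr #|pred_of_set _|; apply/setP => s; rewrite !inE; congr (_ && _); last first.
  by rewrite all_map; apply: eq_all => l /=; rewrite signed_perm_sat.
have sat_c c : sat_clause (signed_perm_assignment pi b s) (signed_perm_clause pi b c)
    = sat_clause s c.
  apply/exists_inP/exists_inP => [[_ /imsetP[l lc ->]]|[l lc]].
    by rewrite signed_perm_sat; exists l.
  by exists (signed_perm pi b l); rewrite ?signed_perm_sat // imset_f.
apply/forall_inP/forall_inP => [sat c cF|sat _ /imsetP[c cF ->]].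
  by rewrite -sat_c; apply: sat; apply: imset_f.
by rewrite sat_c sat.
Qed.

(** The law of the formula is invariant under renaming variables and flipping signs, so transitivity
    makes the effect of fixing literals on distinct variables depend on their number alone. *)
Lemma signed_perm_transitive (t t' : seq (literal n)) : size t = size t' ->
  uniq (map fst t) -> uniq (map fst t') ->
  exists pi b, map (signed_perm pi b) t = t'.
Proof.
elim: t t' => [|l t IH] [|l' t'] //= => [_ _ _|[tt'] /andP[lt ut] /andP[lt' ut']].
  by exists 1%g, [ffun=> false].
have [pi [b tE]] := IH t' tt' ut ut'.
(* The transposition corrects the image of the new variable without moving the images already
   placed. *)
exists (pi * tperm (pi l.1) l'.1)%g.
exists [ffun v => if v == l.1 then l.2 (+) l'.2 else b v].
congr (_ :: _).
  rewrite /signed_perm permM tpermL ffunE eqxx addbA addbb addFb.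
  by case: l' {lt' ut'}.
rewrite -[in RHS]tE; apply/eq_in_map => x xt; rewrite /signed_perm permM ffunE.
have xl : x.1 != l.1 by apply: contraNneq lt => <-; apply: map_f.
rewrite (negPf xl) tpermD //; first by rewrite (inj_eq perm_inj) eq_sym.
apply: contraNneq lt' => ->; rewrite -tE.
by rewrite -map_comp (map_f (fst \o signed_perm pi b)).
Qed.

Definition tuple_clause k (t : {ffun 'I_k -> literal n}) : clause n :=
  [set t i | i in 'I_k].

Lemma sols_tuple_clause k (t : {ffun 'I_k -> literal n}) (G : {set clause n}) :
  tuple_clause t \in G -> sols G \subset tuple_cup lit_sols t.
Proof.
move=> tG; apply/fintype.subsetP => s; rewrite inE => /forall_inP sat; have := sat _ tG.
rewrite /sat_clause => /exists_inP[_ /imsetP[i _ ->] si].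
by apply/bigcupP; exists i; rewrite // inE.
Qed.

Lemma tuple_clause_kclauses k (t : {ffun 'I_k -> literal n}) :
  injective (fun i => (t i).1) -> tuple_clause t \in kclauses n k.
Proof.
move=> ti; have ti' : injective t by move=> i j ij; apply: ti; rewrite /= ij.
rewrite inE /is_kclause card_imset // card_ord eqxx -imset_comp /=.
by rewrite card_imset // card_ord.
Qed.

End Formulas.

Section RandomFormulas.
Variables (R : realType) (n k : nat).
Implicit Types (F G : {set clause n}) (theta : R).

(** The product measure lives on all sets of clauses; probability 0 outside the k-clauses confines
    it to k-CNF formulas. *)
Definition kweight (q : R) (c : clause n) : R :=
  if c \in kclauses n k then q else 0.

Lemma kweight01 q c : 0 <= q <= 1 -> 0 <= kweight q c <= 1.
Proof. by rewrite /kweight; case: ifP => // _ _; rewrite lexx ler01. Qed.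

Lemma P_few_satE alpha phi :
  P_few_sat n k alpha phi =
  prod_mean (kweight (clause_prob n k alpha))
    (fun F => few (2 `^ (n%:R * phi)) (sols F)).
Proof.
rewrite /P_few_sat /cnf_event_prob /prod_mean big_mkcond.
apply: eq_bigr => F _; rewrite finset.powersetE /few -nb_satE /=.
case FK: (_ \subset _) => /=; last first.
  have /subsetPn[c cF cK] : ~~ (F \subset kclauses n k) by apply/negPf; exact: FK.
  by rewrite /prod_weight (bigD1 c) //= cF /kweight (negPf cK) !mul0r.
case: (_ < _) => /=; last by rewrite mulr0.
rewrite mulr1 /cnf_prob /prod_weight big_mkcond; apply: eq_bigr => c _.
rewrite /kweight; case: ifPn => cK //.
rewrite (negPf (_ : c \notin F)) ?subr0 //.
by apply: contra cK; apply: (fintype.subsetP FK).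
Qed.

Lemma few_sols_mono theta F G : F \subset G ->
  few theta (sols F) <= few theta (sols G).
Proof. by move=> FG; apply: few_antitone; apply: sols_antitone. Qed.

Lemma prod_mean_cube q theta (t t' : seq (literal n)) : size t = size t' ->
  uniq (map fst t) -> uniq (map fst t') ->
  prod_mean (kweight q) (fun F => few theta (sols F :&: cube t)) =
  prod_mean (kweight q) (fun F => few theta (sols F :&: cube t')).
Proof.
move=> tt' ut /(signed_perm_transitive tt' ut)[pi [b <-]].
rewrite [RHS](@prod_mean_perm _ _ _ (signed_perm_clause pi b)).
- by apply: eq_prod_mean => F; rewrite /few sols_signed_perm.
- exact: imset_inj (@signed_perm_inj _ pi b).
- by move=> c; rewrite /kweight signed_perm_kclauses.
Qed.

Lemma avg_literal_var (P : pred 'I_n) : (0 < n)%N ->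
  avg (fun l : literal n => (P l.1)%:R : R) = #|P|%:R / n%:R.
Proof.
move=> n0; rewrite /avg card_prod card_ord card_bool natrM.
rewrite -(pair_bigA _ (fun v _ => (P v)%:R)) /=.
under eq_bigr => v _ do rewrite big_bool /= -mulr2n -[_ *+ 2]mulr_natr.
rewrite -mulr_suml -natr_sum -sum1_card [in RHS]big_mkcond /=.
rewrite (eq_bigr (fun v => if P v then 1 else 0)%N); last by move=> v _; case: (P v).
by rewrite -mulf_div divff ?mulr1 // pnatr_eq0.
Qed.

Lemma avg_lit_sols (s : assignment n) : (0 < n)%N ->
  avg (fun l : literal n => (s \in lit_sols l)%:R : R) = 1 / 2.
Proof.
move=> n0; rewrite /avg card_prod card_ord card_bool natrM.
under eq_bigr => l _ do rewrite inE.
rewrite -(pair_bigA _ (fun v b => (s v == b)%:R)) /=.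
have sum1 v : \sum_b (s v == b)%:R = 1 :> R.
  by rewrite big_bool /=; case: (s v); rewrite ?addr0 ?add0r.
under eq_bigr => v _ do rewrite sum1.
rewrite sumr_const card_ord; field; by rewrite pnatr_eq0 -lt0n.
Qed.

(** Random literals may repeat a variable. Each draw brings a new one with probability at least
    [1 - D / n], and a draw that does not still leaves a mean of at least [a], since cutting only
    removes assignments. *)
Lemma avg_cut_cube_lower q theta (D : nat) (a b : R) : (0 < n)%N -> (D <= n)%N ->
  0 <= q <= 1 -> 0 <= b ->
  a <= prod_mean (kweight q) (fun F => few theta (sols F)) ->
  (forall t : seq (literal n), uniq (map fst t) -> size t = D ->
     a + b <= prod_mean (kweight q) (fun F => few theta (sols F :&: cube t))) ->
  forall r (t : seq (literal n)), uniq (map fst t) -> (size t + r = D)%N ->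
  a + b * (1 - D%:R / n%:R) ^+ r <= prod_mean (kweight q) (fun F =>
     avg_cut (@lit_sols n) r (few theta) (sols F :&: cube t)).
Proof.
move=> n0 Dn q01 b0 aP bP; have L0 : (0 < #|literal n|)%N.
  by rewrite card_prod card_ord card_bool muln_gt0 n0.
have x01 : 0 <= 1 - D%:R / n%:R :> R.
  by rewrite subr_ge0 ler_pdivrMr ?ltr0n // mul1r ler_nat.
elim=> [|r IH] t ut tD /=.
  by rewrite expr0 mulr1; apply: bP; rewrite // -tD addn0.
have -> : prod_mean (kweight q) (fun F => avg (fun l =>
      avg_cut (@lit_sols n) r (few theta) (sols F :&: cube t :&: lit_sols l))) =
    avg (fun l => prod_mean (kweight q) (fun F =>
      avg_cut (@lit_sols n) r (few theta) (sols F :&: cube (l :: t)))).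
  rewrite /avg mulrC -prod_mean_sum -prod_meanZ; apply: eq_prod_mean => F.
  rewrite mulrC; congr (_ * _); apply: eq_bigr => l _.
  by rewrite cube_cons finset.setIAC finset.setIA.
apply: (@le_trans _ _ (avg (fun l : literal n =>
    a + b * (1 - D%:R / n%:R) ^+ r * (l.1 \notin map fst t)%:R))).
  rewrite avgD avg_cst // avgZ exprSr mulrA lerD2l ler_wpM2l //.
    by rewrite mulr_ge0 // exprn_ge0.
  rewrite (avg_literal_var (fun v => v \notin map fst t)) //.
  have -> : #|(fun v : 'I_n => v \notin map fst t)| = (n - size t)%N.
    have := cardC (mem (map fst t)); rewrite card_ord (card_uniqP ut) size_map.
    by move/(canRL (addKn _)).
  rewrite natrB; last by lia.
  rewrite mulrBl divff ?pnatr_eq0 -?lt0n // lerD2l lerN2 ler_wpM2r ?invr_ge0 //.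
  by rewrite ler_nat; lia.
apply: ler_avg => l; have [lt|lt] := boolP (l.1 \in map fst t).
  rewrite mulr0 addr0 (le_trans aP) //; apply: ler_prod_mean => [c|F]; first exact: kweight01.
  by apply: few_le_avg_cut => //; apply: finset.subsetIl.
rewrite mulr1; apply: IH => /=; first by rewrite lt.
by rewrite -tD addSnnS.
Qed.

End RandomFormulas.

(** * Hitting dense sets of tuples with batches of random clauses *)

Lemma bernoulli_ge (R : realFieldType) (x : R) m : 0 <= x <= 1 ->
  1 - m%:R * x <= (1 - x) ^+ m.
Proof.
move=> /andP[x0 x1]; elim: m => [|m IH]; first by rewrite mul0r subr0 expr0.
rewrite exprS; apply: le_trans (ler_wpM2l _ IH); last by rewrite subr_ge0.
rewrite -natr1; have : 0 <= m%:R * x ^+ 2 by rewrite mulr_ge0 ?sqr_ge0.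
by lra.
Qed.

Lemma bernoulli_le (R : realFieldType) (x : R) m : 0 <= x <= 1 ->
  (1 - x) ^+ m * (1 + m%:R * x) <= 1.
Proof.
move=> /andP[x0 x1]; elim: m => [|m IH]; first by rewrite mul0r addr0 expr0 mul1r.
rewrite exprSr -mulrA; apply: le_trans IH; rewrite ler_wpM2l ?exprn_ge0 ?subr_ge0 //.
rewrite -natr1; have : 0 <= (m%:R + 1) * x ^+ 2 by rewrite mulr_ge0 ?sqr_ge0 ?addr_ge0.
by lra.
Qed.

Lemma ffact_ge n k : (k <= n)%N -> ((n - k) ^ k <= n ^_ k)%N.
Proof.
elim: k => [//|k IH] kn; rewrite ffactnSr expnSr leq_mul //; last by lia.
apply: leq_trans (IH (ltnW kn)); case: (posnP k) => [->//|k0].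
by rewrite leq_exp2r // leq_sub2l.
Qed.

Lemma ffact_ge_real (R : realFieldType) n k : (k <= n)%N -> (0 < n)%N ->
  n%:R ^+ k * (1 - (k ^ 2)%:R / n%:R) <= (n ^_ k)%:R :> R.
Proof.
move=> kn n0; have n0' : 0 < n%:R :> R by rewrite ltr0n.
have x01 : 0 <= (k%:R / n%:R : R) <= 1.
  by rewrite divr_ge0 // ler_pdivrMr // mul1r ler_nat.
apply: (@le_trans _ _ ((n - k) ^ k)%:R); last by rewrite ler_nat ffact_ge.
have := bernoulli_ge k x01; rewrite mulrA -natrM mulnn.
move/(ler_wpM2l (exprn_ge0 k (ltW n0')))/le_trans; apply.
by rewrite -exprMn mulrBr mulr1 mulrCA divff ?gt_eqF // mulr1 natrX natrB.
Qed.

Section Rounds.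
Variables (R : realType) (n k : nat).
Hypothesis n0 : (0 < n)%N.
Hypothesis k0 : (0 < k)%N.
Implicit Types (F G : {set clause n}) (theta : R).

Lemma prod_mean_disjoint (q : R) (B : {set clause n}) : B \subset kclauses n k ->
  prod_mean (kweight k q) (fun G => [disjoint G & B]%:R) = (1 - q) ^+ #|B|.
Proof.
move=> BK; transitivity (prod_mean (kweight k q) (fun G =>
    \prod_c (if c \in B then (c \notin G)%:R else 1))).
  apply: eq_prod_mean => G; rewrite -big_mkcond /=.
  case: (boolP [disjoint G & B]) => [/pred0P GB|/pred0Pn[c /andP[/= cG cB]]].
    rewrite big1 // => c cB; have := GB c; rewrite /= => /negbT.
    by rewrite negb_and => /orP[->//|]; rewrite [c \in _]cB.
  by rewrite (bigD1 c) //= cG mul0r.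
rewrite (prod_mean_prod (kweight k q)
  (fun c b => if c \in B then (~~ b)%:R else 1)) -prodr_const big_mkcond [RHS]big_mkcond /=.
apply: eq_bigr => c _; rewrite /kweight; case: (boolP (c \in B)) => cB.
  by rewrite (fintype.subsetP BK) // mulr0 add0r mulr1.
by rewrite !mulr1 addrC subrK.
Qed.

Definition spread_tuples : {set {ffun 'I_k -> literal n}} :=
  [set t : {ffun 'I_k -> literal n} | injectiveb (fun i => (t i).1)].

Lemma card_spread_tuples : (2 ^ k * n ^_ k <= #|spread_tuples|)%N.
Proof.
pose mk (u : {ffun 'I_k -> 'I_n} * {ffun 'I_k -> bool}) : {ffun 'I_k -> literal n} :=
  [ffun i => (u.1 i, u.2 i)].
have mki : injective mk.
  move=> [v s] [w s'] /ffunP vw; congr (_, _); apply/ffunP => i;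
  by have := vw i; rewrite !ffunE => -[].
pose D := [set u : {ffun 'I_k -> 'I_n} * {ffun 'I_k -> bool} | injectiveb u.1].
have <- : #|D| = (2 ^ k * n ^_ k)%N.
  rewrite mulnC -[in RHS](card_ord n) -[k in _ ^_ k]card_ord -card_inj_ffuns.
  have -> : (2 ^ k = #|[set: {ffun 'I_k -> bool}]|)%N.
    by rewrite cardsT card_ffun card_bool card_ord.
  by rewrite -cardsX; apply: eq_card => u; rewrite !inE andbT.
rewrite -(card_imset _ mki) subset_leq_card //.
apply/fintype.subsetP => _ /imsetP[u uD ->]; rewrite inE.
move: uD; rewrite inE => /injectiveP ui; apply/injectiveP => i j.
by rewrite /= !ffunE /=; apply: ui.
Qed.

(** All but a fraction [k ^ 2 / n] of the tuples have distinct variables, and a k-clause arises from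
    at most [k ^ k] tuples. *)
Lemma card_hit_clauses (beta : R) (B : {set {ffun 'I_k -> literal n}}) :
  (k <= n)%N -> (k ^ 2)%:R / n%:R <= beta / 2 ->
  beta * (n * 2)%:R ^+ k <= #|B|%:R ->
  beta / 2 * (n * 2)%:R ^+ k <=
    k%:R ^+ k * #|[set tuple_clause t | t in B :&: spread_tuples]|%:R.
Proof.
move=> kn kb Bb; set B' := [set _ | _ in _].
have BB' : (#|B :&: spread_tuples| <= k ^ k * #|B'|)%N.
  have sub : B :&: spread_tuples \subset \bigcup_(c in B') [set t | tuple_clause t == c].
    apply/fintype.subsetP => t tB; apply/bigcupP; exists (tuple_clause t); last by rewrite inE.
    exact: imset_f.
  apply: leq_trans (subset_leq_card sub) _; rewrite mulnC -sum_nat_const.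
  apply: (@leq_trans (\sum_(c in B') #|[set t : {ffun 'I_k -> literal n} | tuple_clause t == c]|)).
    apply: (big_ind2 (fun (X : {set {ffun 'I_k -> literal n}}) m => #|X| <= m)%N) => //.
      by rewrite cards0.
    move=> X m X' m' Xm X'm'.
    by rewrite (leq_trans (leq_card_setU _ _)) // leq_add.
  apply: leq_sum => c /imsetP[t]; rewrite inE => /andP[_ tS] cE.
  have ck : #|c| = k.
    have : c \in kclauses n k.
      by move: tS; rewrite inE => /injectiveP ti; rewrite cE; apply: tuple_clause_kclauses.
    by rewrite inE => /andP[/eqP].
  rewrite -[X in (_ <= X ^ _)%N]ck -[k in (_ ^ k)%N]card_ord -card_ffun_on subset_leq_card //.
  apply/fintype.subsetP => t'; rewrite inE => /eqP <-; apply/ffun_onP => i.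
  exact: imset_f.
apply: (@le_trans _ _ #|B :&: spread_tuples|%:R); last first.
  by rewrite -natrX -natrM ler_nat.
have : #|B|%:R <= #|B :&: spread_tuples|%:R + #|~: spread_tuples|%:R :> R.
  rewrite -natrD ler_nat -(cardsID spread_tuples B) leq_add2l subset_leq_card //.
  by apply/fintype.subsetP => t; rewrite !inE => /andP[].
have : #|~: spread_tuples|%:R <= (k ^ 2)%:R / n%:R * (n * 2)%:R ^+ k :> R.
  have -> : #|~: spread_tuples|%:R = (n * 2)%:R ^+ k - #|spread_tuples|%:R :> R.
    have := cardsC spread_tuples; rewrite card_ffun card_prod !card_ord card_bool.
    by move/(congr1 (fun x => x%:R : R)); rewrite natrD natrX => <-; rewrite addrC addKr.
  rewrite lerBlDr; apply: le_trans (lerD (lexx _) (_ : (2 ^ k * n ^_ k)%:R <= _)); last first.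
    by rewrite ler_nat card_spread_tuples.
  rewrite [(2 ^ k * _)%:R]natrM; have := @ffact_ge_real R n k kn n0.
  move/(ler_wpM2l (_ : 0 <= (2 ^ k)%:R)) => /(_ (ler0n _ _)).
  have -> : (n * 2)%:R ^+ k = (2 ^ k)%:R * n%:R ^+ k :> R.
    by rewrite natrM exprMn mulrC natrX.
  lra.
have : (k ^ 2)%:R / n%:R * (n * 2)%:R ^+ k <= beta / 2 * (n * 2)%:R ^+ k :> R.
  by rewrite ler_wpM2r ?exprn_ge0.
move: Bb; lra.
Qed.

(** The batch is expected to contain at least [1 / eta] clauses coming from [B], and missing all of
    [m] clauses has probability at most [1 / (1 + m q)]. *)
Lemma miss_prob (beta eta q : R) (B : {set {ffun 'I_k -> literal n}}) :
  (k <= n)%N -> 0 <= q <= 1 -> 0 < eta -> 0 < beta -> (k ^ 2)%:R / n%:R <= beta / 2 ->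
  beta * (n * 2)%:R ^+ k <= #|B|%:R ->
  k%:R ^+ k <= eta * q * (beta / 2 * (n * 2)%:R ^+ k) ->
  prod_mean (kweight k q) (fun G => (~~ [exists t in B, tuple_clause t \in G])%:R)
    <= eta.
Proof.
move=> kn q01 eta0 beta0 kb Bb qb.
set B' := [set tuple_clause t | t in B :&: spread_tuples].
have cB' := card_hit_clauses kn kb Bb.
have B'K : B' \subset kclauses n k.
  apply/fintype.subsetP => _ /imsetP[t tB ->].
  by apply: tuple_clause_kclauses; move: tB; rewrite !inE => /andP[_ /injectiveP].
apply: (@le_trans _ _ (prod_mean (kweight k q) (fun G => [disjoint G & B']%:R))).
  apply: ler_prod_mean => [c|G]; first exact: kweight01.
  rewrite ler_nat; case: (boolP [exists t in B, tuple_clause t \in G]) => //= miss.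
  rewrite lt0b; apply/pred0P => c /=; apply/negbTE; apply: contra miss.
  case/andP=> cG /imsetP[t]; rewrite inE => /andP[tB _] cE.
  by apply/exists_inP; exists t; rewrite // -cE.
rewrite prod_mean_disjoint //.
have := bernoulli_le #|B'| q01; set x := (1 - q) ^+ _ => xle.
have x0 : 0 <= x by case/andP: q01 => _ q1; rewrite exprn_ge0 // subr_ge0.
have kk0 : 0 < k%:R ^+ k :> R by rewrite exprn_gt0 // ltr0n.
have : 1 <= eta * q * #|B'|%:R.
  have q0 : 0 <= eta * q by case/andP: q01 => q0 _; rewrite mulr_ge0 // ltW.
  have := ler_wpM2l q0 cB'; rewrite [leRHS]mulrCA => /(le_trans qb).
  by rewrite -[leLHS]mulr1 ler_pM2l.
move=> /(ler_wpM2l x0); move: xle; move: eta0; nra.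
Qed.

Lemma kweightU q q' : (fun c => kweight k q c + kweight k q' c - kweight k q c * kweight k q' c)
  =1 kweight k (q + q' - q * q' : R) :> (clause n -> R).
Proof. by move=> c; rewrite /kweight; case: ifP => // _; rewrite mulr0 !addr0 subr0. Qed.

Lemma prod_mean_kweightU (q q' : R) f :
  prod_mean (kweight k q) (fun F : {set clause n} =>
    prod_mean (kweight k q') (fun G => f (F :|: G))) =
  prod_mean (kweight k (q + q' - q * q')) f.
Proof.
rewrite prod_mean_setU; apply: eq_bigr => F _; congr (_ * _).
by apply: eq_bigr => c _; rewrite kweightU.
Qed.

Lemma prod_mean_kweight_mono (q q' : R) (f : {set clause n} -> R) :
  (forall F G : {set clause n}, F \subset G -> f F <= f G) ->
  0 <= q -> q <= q' -> q' <= 1 ->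
  prod_mean (kweight k q) f <= prod_mean (kweight k q') f.
Proof.
move=> fm q0 qq' q'1; have [q1|q1] := leP 1 q.
  by rewrite (_ : q' = q) //; apply/eqP; rewrite eq_le qq' (le_trans q'1).
(* Coupling: the denser formula is the sparser one united with an independent formula of density
   [(q' - q) / (1 - q)]. *)
have -> : q' = q + (q' - q) / (1 - q) - q * ((q' - q) / (1 - q)).
  by field; rewrite subr_eq0 gt_eqF.
rewrite -prod_mean_kweightU; apply: ler_prod_mean => [c|F].
  by apply: kweight01; rewrite q0 ltW.
rewrite -[leLHS](@prod_mean_cst _ _ (kweight (n := n) k ((q' - q) / (1 - q)))).
apply: ler_prod_mean => [c|G]; last by rewrite fm // finset.subsetUl.
apply: kweight01; rewrite divr_ge0 ?subr_ge0 ?(ltW q1) //.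
by rewrite ler_pdivrMr ?subr_gt0 // mul1r lerD2r.
Qed.

Fixpoint rounds (q : R) (m : nat) (f : {set clause n} -> R) F : R :=
  if m is m'.+1 then prod_mean (kweight k q) (fun G => rounds q m' f (F :|: G)) else f F.

Lemma rounds_ge0 q m f F : 0 <= q <= 1 -> (forall F, 0 <= f F) -> 0 <= rounds q m f F.
Proof.
move=> q01 f0; elim: m F => [|m IH] F //=.
by apply: prod_mean_ge0 => // c; apply: kweight01.
Qed.

Lemma rounds_mono q m f (F G : {set clause n}) : 0 <= q <= 1 ->
  (forall F G : {set clause n}, F \subset G -> f F <= f G) ->
  F \subset G -> rounds q m f F <= rounds q m f G.
Proof.
move=> q01 fm; elim: m F G => [|m IH] F G FG /=; first exact: fm.
apply: ler_prod_mean => [c|H]; first exact: kweight01.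
by apply: IH; apply: finset.setSU.
Qed.

Lemma rounds_mean (q a : R) m f : 0 <= q -> 0 <= a -> a + m%:R * q <= 1 ->
  (forall F G : {set clause n}, F \subset G -> f F <= f G) ->
  prod_mean (kweight k a) (rounds q m f) <= prod_mean (kweight k (a + m%:R * q)) f.
Proof.
move=> q0; elim: m a => [|m IH] a a0 am fm /=; first by rewrite mul0r addr0.
have mq0 : 0 <= m%:R * q by rewrite mulr_ge0.
move: am; rewrite -natr1 mulrDl mul1r => am.
have q1 : q <= 1 by lra.
have q01 : 0 <= q <= 1 by rewrite q0.
rewrite prod_mean_kweightU; apply: le_trans (_ : prod_mean (kweight k (a + q)) (rounds q m f) <= _).
  apply: prod_mean_kweight_mono => [F G|||]; first exact: rounds_mono.
  - have : 0 <= (1 - a) * q by rewrite mulr_ge0 //; lra.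
    by lra.
  - by rewrite gerBl mulr_ge0.
  - by lra.
by have := IH (a + q) (addr_ge0 a0 q0); rewrite -addrA [q + _]addrC; apply.
Qed.

(** Amplification from a small average to near certainty. A proportion at least [beta] of first
    tuples keeps half of the required average; a batch contains the clause of such a tuple except
    with probability [eta], and the induction continues from the enlarged formula. *)
Lemma rounds_hit (q beta eta theta : R) : 0 <= q <= 1 ->
  0 < theta -> 0 < beta ->
  (forall B : {set {ffun 'I_k -> literal n}}, beta * (n * 2)%:R ^+ k <= #|B|%:R ->
     prod_mean (kweight k q) (fun G => (~~ [exists t in B, tuple_clause t \in G])%:R) <= eta) ->
  forall m F, 2 ^+ m * beta <=
     avg_cut (tuple_cup (@lit_sols n) (k := k)) m (few theta) (sols F) ->
  1 - m%:R * eta <= rounds q m (fun F => few theta (sols F)) F.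
Proof.
move=> q01 th0 beta0 miss; have T0 : (0 < #|{ffun 'I_k -> literal n}|)%N.
  by rewrite card_ffun card_prod card_ord card_bool expn_gt0 muln_gt0 n0.
elim=> [|m IH] F /=.
  rewrite expr0 mul1r mul0r subr0 => /(lt_le_trans beta0).
  by rewrite /few ltr0n lt0b => ->.
pose a (t : {ffun 'I_k -> literal n}) :=
  avg_cut (tuple_cup (@lit_sols n) (k := k)) m (few theta) (sols F :&: tuple_cup (@lit_sols n) t).
pose B := [set t | 2 ^+ m * beta <= a t].
move=> avgb; have cB : beta * (n * 2)%:R ^+ k <= #|B|%:R.
  have T0' : 0 < (n * 2)%:R ^+ k :> R by rewrite exprn_gt0 // ltr0n muln_gt0 n0.
  have avgle : avg a <= #|B|%:R / (n * 2)%:R ^+ k + 2 ^+ m * beta.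
    apply: le_trans (_ : avg (fun t => (t \in B)%:R + 2 ^+ m * beta) <= _).
      apply: ler_avg => t; have [tB|] := boolP (t \in B).
        apply: ler_wpDr; first by rewrite mulr_ge0 ?exprn_ge0 ?ltW.
        rewrite -[leRHS](avg_cut_cst (tuple_cup (@lit_sols n) (k := k)) T0 m 1
          (sols F :&: tuple_cup (@lit_sols n) t)).
        by apply: ler_avg_cut => Y; case/andP: (few01 theta Y).
      by rewrite inE -ltNge add0r => /ltW.
    rewrite avgD avg_cst // lerD2r /avg card_ffun card_prod !card_ord card_bool natrX.
    by rewrite -natr_sum -sum1_card [in leRHS]big_mkcond.
  have : 2 ^+ m.+1 * beta <= #|B|%:R / (n * 2)%:R ^+ k + 2 ^+ m * beta.
    exact: le_trans avgb avgle.
  rewrite exprS -mulrA mulrDl !mul1r lerD2r ler_pdivlMr // => /(le_trans _); apply.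
  by rewrite ler_wpM2r ?(ltW T0') // ler_peMl ?(ltW beta0) // exprn_ege1 // ler1n.
have q01' c : 0 <= kweight k q c <= 1 by apply: kweight01.
apply: (@le_trans _ _ (prod_mean (kweight k q) (fun G =>
    1 - m%:R * eta - (~~ [exists t in B, tuple_clause t \in G])%:R))).
  rewrite prod_meanB prod_mean_cst -natr1 mulrDl mul1r opprD addrA lerD2l lerN2.
  exact: miss.
apply: ler_prod_mean => // G.
have eta0 : 0 <= eta.
  by apply: le_trans (miss B cB); apply: prod_mean_ge0.
case: (boolP [exists t in B, tuple_clause t \in G]) => [/exists_inP[t tB tG]|_] /=; last first.
  apply: (@le_trans _ _ 0); last first.
    by apply: rounds_ge0 => // H; apply: few_ge0.
  by rewrite addrAC subrr add0r oppr_le0 mulr_ge0.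
rewrite subr0; apply: IH; move: tB; rewrite inE => /le_trans; apply.
apply: avg_cut_antitone => [X Y|]; first exact: few_antitone.
by rewrite solsU finset.setIS // sols_tuple_clause.
Qed.

End Rounds.

Lemma eventually_div_le (R : realType) (C eps : R) : 0 <= C -> 0 < eps ->
  exists n0 : nat, forall n, (n0 <= n)%N -> (0 < n)%N /\ C / n%:R <= eps.
Proof.
move=> C0 e0; exists (Num.bound (C / eps)).+1 => n n0.
have n_gt0 : (0 < n)%N by apply: leq_trans n0.
split=> //; rewrite ler_pdivrMr ?ltr0n // mulrC -ler_pdivrMr //.
apply: ltW; apply: lt_le_trans (archi_boundP _) _; first by rewrite divr_ge0 // ltW.
by rewrite ler_nat ltnW.
Qed.

(** * Clause sets on too few variables, and the Fourier weight they carry *)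

Section Deficient.
Variables (n k : nat).

Definition clauses_vars (B : {set clause n}) : {set 'I_n} :=
  \bigcup_(c in B) clause_vars c.

Definition deficient (D : nat) (B : {set clause n}) :=
  [&& B \subset kclauses n k, #|B| <= D & #|clauses_vars B| < #|B|]%N.

(* A deficient set with [j] clauses lives on at most [j - 1] variables, so the
   mean number of such sets in the random formula is [O(1/n)]. *)
Definition hall_family (D : nat) (S : {set clause n}) :=
  [&& S \subset kclauses n k, (#|S| <= D)%N &
   [forall B : {set clause n}, (B \subset S) ==> (#|B| <= #|clauses_vars B|)%N]].

Lemma hall_family_sub D (S U : {set clause n}) : hall_family D S -> U \subset S -> hall_family D U.
Proof.
case/and3P=> SK SD /forallP Sd US; apply/and3P; split.
- exact: fintype.subset_trans SK.
- exact: leq_trans (subset_leq_card US) SD.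
- apply/forallP => B; apply/implyP => BU; have /implyP := Sd B; apply.
  exact: fintype.subset_trans US.
Qed.

(** At most [j - 1] variables occur: they are covered by one of [n ^ j.-1] maps, and then [B] is
    some set of sets of literals on them. *)
Lemma card_deficient D j : (0 < n)%N -> (j <= D)%N ->
  (#|[set B | deficient D B & #|B| == j]| <= n ^ j.-1 * 2 ^ (2 ^ (D * 2)))%N.
Proof.
move=> n0 jD; pose v0 := Ordinal n0.
pose lits (h : {ffun 'I_j.-1 -> 'I_n}) : {set literal n} :=
  setX (h @: finset.setT) finset.setT.
have sub : [set B | deficient D B & #|B| == j] \subset
    \bigcup_(h : {ffun 'I_j.-1 -> 'I_n}) powerset (powerset (lits h)).
  apply/fintype.subsetP => B; rewrite inE => /andP[/and3P[BK BD Bv] /eqP Bj].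
  pose h := [ffun i : 'I_j.-1 => nth v0 (enum (clauses_vars B)) i].
  apply/bigcupP; exists h => //; rewrite inE; apply/fintype.subsetP => c cB.
  rewrite inE; apply/fintype.subsetP => l lc; rewrite !inE andbT.
  have lB : l.1 \in enum (clauses_vars B).
    by rewrite mem_enum; apply/bigcupP; exists c => //; apply: imset_f.
  have il : (index l.1 (enum (clauses_vars B)) < j.-1)%N.
    move: lB; rewrite -index_mem -cardE => /leq_trans; apply.
    by rewrite -Bj; case: #|B| Bv.
  apply/imsetP; exists (Ordinal il); first by rewrite inE.
  by rewrite ffunE /= nth_index.
apply: leq_trans (subset_leq_card sub) _.
apply: (@leq_trans (\sum_(h : {ffun 'I_j.-1 -> 'I_n}) #|powerset (powerset (lits h))|)).
  apply: (big_ind2 (fun (X : {set {set clause n}}) m => #|X| <= m)%N) => //.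
    by rewrite cards0.
  move=> X m X' m' Xm X'm'.
  by rewrite (leq_trans (leq_card_setU _ _)) // leq_add.
rewrite -[X in (_ <= X ^ _ * _)%N](card_ord n) -[X in (_ <= _ ^ X * _)%N](card_ord j.-1).
rewrite -card_ffun -sum_nat_const; apply: leq_sum => h _.
rewrite !card_powerset !leq_exp2l // /lits cardsX cardsT card_bool leq_mul2r /=.
by rewrite (leq_trans (leq_imset_card _ _)) // cardsT card_ord; lia.
Qed.

(** The base [4 q] combines the [4 ^ #|B|] of the derivative bound with the variances of the clauses
    of [B]. As [n q] is bounded, [n ^ (j - 1) * q ^ j] is [O(1 / n)]. *)
Lemma sum_deficient (R : realType) (D : nat) (q x : R) : (0 < n)%N -> 0 <= q ->
  1 <= x -> n%:R * q <= x ->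
  \sum_(B : {set clause n} | deficient D B) (4 * q) ^+ #|B| <=
  D.+1%:R * ((2 ^ (2 ^ (D * 2)))%:R * (4 * x) ^+ D) / n%:R.
Proof.
move=> n0 q0 x1 nq; have n0' : 0 < n%:R :> R by rewrite ltr0n.
rewrite (partition_big (fun B : {set clause n} => inord #|B| : 'I_D.+1) predT) //=.
apply: (@le_trans _ _ (\sum_(j < D.+1) (2 ^ (2 ^ (D * 2)))%:R * (4 * x) ^+ D / n%:R)).
  2: by rewrite sumr_const card_ord -[leLHS]mulr_natl mulrA.
apply: ler_sum => j _; rewrite ler_pdivlMr //.
have jD : (j <= D)%N by rewrite -ltnS.
apply: (@le_trans _ _ (\sum_(B : {set clause n} | deficient D B && (#|B| == j))
    (4 * q) ^+ j * n%:R)).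
  rewrite mulr_suml big_mkcond [leRHS]big_mkcond /=; apply: ler_sum => B _.
  case: (boolP (deficient D B)) => //= /and3P[_ BD _].
  rewrite -(inj_eq val_inj) /= inordK ?ltnS //.
  by case: eqP => // ->.
rewrite sumr_const -[X in _ *+ X](@eq_card _ [set B | deficient D B & #|B| == j]); last first.
  by move=> B; rewrite inE.
case: (posnP j) => [j0|j0].
  rewrite eq_card0 ?mulr0n; last first.
    by move=> B; rewrite !inE j0; apply/negbTE/negP => /andP[/and3P[_ _]]; case: #|B|.
  by rewrite mulr_ge0 // exprn_ge0 // mulr_ge0 // (le_trans _ x1).
rewrite -[_ *+ #|_|]mulr_natl.
apply: (@le_trans _ _ ((n ^ j.-1 * 2 ^ (2 ^ (D * 2)))%:R * ((4 * q) ^+ j * n%:R))).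
  rewrite ler_wpM2r ?ler_nat ?card_deficient // mulr_ge0 ?exprn_ge0 // mulr_ge0 //.
rewrite natrM mulrC mulrA mulrC ler_wpM2l //.
apply: (@le_trans _ _ ((4 * x) ^+ j)); last first.
  by rewrite ler_weXn2l //; move: x1; lra.
rewrite [X in _ * X](_ : _ = n%:R ^+ j.-1); last by rewrite natrX.
rewrite -mulrA -exprS prednK // -exprMn lerXn2r ?nnegrE ?mulr_ge0 ?(le_trans _ x1) //.
by rewrite -mulrA ler_wpM2l // mulrC.
Qed.

End Deficient.

Section Truncation.
Variables (R : realType) (n k : nat) (q theta : R).
Hypothesis q01 : 0 <= q <= 1.
Let p := kweight (n := n) k q.
Let f (F : {set clause n}) : R := few theta (sols F).
Let few_pred (F : {set clause n}) : bool := #|sols F|%:R < theta.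

Let p01 c : 0 <= p c <= 1. Proof. exact: kweight01. Qed.

Let few_pred_mono (F G : {set clause n}) : F \subset G -> few_pred F -> few_pred G.
Proof.
move=> FG; rewrite /few_pred; apply: le_lt_trans.
by rewrite ler_nat subset_leq_card // sols_antitone.
Qed.

Let gain (c : clause n) : R :=
  bvar p c * prod_mean p (fun F => f (c |: F) - f (F :\ c)).

(** The weight of the nonempty sets is the variance [P (1 - P)] of the indicator. Sets larger than
    [D] carry at most [K / D], because the total influence counts [S] with multiplicity [#|S|];
    supersets of deficient sets are bounded by [sum_deficient]. *)
Lemma hall_family_weight (D : nat) (K x : R) (c : {set clause n} -> R) : (0 < n)%N -> (0 < D)%N ->
  1 <= x -> n%:R * q <= x ->
  f =1 chaos p c -> \sum_e gain e <= K ->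
  prod_mean p f * (1 - prod_mean p f) - K / D%:R
    - D.+1%:R * ((2 ^ (2 ^ (D * 2)))%:R * (4 * x) ^+ D) / n%:R <=
  \sum_(S : {set clause n} | hall_family k D S && (S != finset.set0)) c S ^+ 2 * bvars p S.
Proof.
move=> n0 D0 x1 nq fc gK; have q0 : 0 <= q by case/andP: q01.
pose W S := c S ^+ 2 * bvars p S.
have W0 S : 0 <= W S by rewrite mulr_ge0 ?sqr_ge0 ?bvars_ge0.
have ff F : f F ^+ 2 = f F by rewrite /f /few; case: (_ < _)%R; rewrite /= ?expr1n ?expr0n.
have sumW : \sum_S W S = prod_mean p f.
  rewrite -[LHS]/(cnorm2 p c) -chaos_mean2.
  by apply: eq_prod_mean => F; rewrite -fc ff.
have c0 : c finset.set0 = prod_mean p f.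
  pose one (S : {set clause n}) : R := (S == finset.set0)%:R.
  have := chaos_mean p c one; rewrite (bigD1 finset.set0) //= big1 ?addr0 => [|S S0]; last first.
    by rewrite /one (negPf S0) mulr0 mul0r.
  rewrite /one eqxx mulr1 /bvars big_set0 mulr1 => <-.
  apply: eq_prod_mean => F; rewrite -fc /chaos (bigD1 finset.set0) //= big1 ?addr0 => [|S S0]; last first.
    by rewrite (negPf S0) mul0r.
  by rewrite eqxx /monom big_set0 !mulr1.
have sumW0 : \sum_(S | S != finset.set0) W S = prod_mean p f * (1 - prod_mean p f).
  have := sumW; rewrite (bigD1 finset.set0) //= /W c0 /bvars big_set0 mulr1 => /(canRL (addKr _)) ->.
  by ring.
have sumWe e : \sum_(S : {set clause n} | e \in S) W S = gain e.
  rewrite /gain -(cnorm2_cderiv1_ind few_pred_mono e fc) -[bvar p e](_ : bvars p [set e] = _); last first.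
    by rewrite /bvars big_set1.
  by rewrite cnorm2_cderiv; apply: eq_bigl => S; rewrite sub1set.
have large : \sum_(S : {set clause n} | (D < #|S|)%N) W S <= K / D%:R.
  rewrite ler_pdivlMr ?ltr0n //; apply: le_trans gK.
  under [leRHS]eq_bigr => e _ do rewrite -sumWe big_mkcond.
  rewrite exchange_big mulr_suml big_mkcond /=; apply: ler_sum => S _.
  rewrite -big_mkcond sumr_const; case: ifP => [DS|_]; last by rewrite mulrn_wge0.
  rewrite -[leRHS]mulr_natr ler_wpM2l // ler_nat ltnW //.
have bad : \sum_(B : {set clause n} | deficient k D B) \sum_(S : {set clause n} | B \subset S) W S <=
    D.+1%:R * ((2 ^ (2 ^ (D * 2)))%:R * (4 * x) ^+ D) / n%:R.
  apply: le_trans (sum_deficient k D n0 q0 x1 nq).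
  apply: ler_sum => B /and3P[BK BD Bv]; rewrite -cnorm2_cderiv exprMn mulrC.
  have B0 : B != finset.set0 by rewrite -card_gt0 (leq_ltn_trans _ Bv).
  apply: ler_pM; rewrite ?cnorm2_ge0 ?bvars_ge0 //.
    apply: le_trans (cnorm2_cderiv_bound p01 few_pred_mono fc B0) _.
    rewrite ler_piMr ?exprn_ge0 // -[leRHS](prod_mean_cst p).
    apply: ler_prod_mean => // F.
    have FB : F :\: B \subset F :|: B.
      by apply/fintype.subsetP => y; rewrite !inE => /andP[_ ->].
    by case/andP: (ind_diff01 R few_pred_mono FB).
  rewrite /bvars -prodr_const; apply: ler_prod => e eB.
  rewrite bvar_ge0 //= /bvar /p /kweight (fintype.subsetP BK) //.
  by rewrite ler_piMr // gerBl.
rewrite -sumW0 -addrA -opprD lerBlDr.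
apply: le_trans (lerD (lexx _) (lerD large bad)).
rewrite big_mkcond [X in _ <= X + _]big_mkcond [X in _ <= _ + (X + _)]big_mkcond.
under [X in _ <= _ + (_ + X)]eq_bigr => B _ do rewrite big_mkcond.
rewrite [X in _ <= _ + (_ + X)]exchange_big -!big_split /=; apply: ler_sum => S _.
case: (boolP (S == finset.set0)) => [_|S0] /=.
  by rewrite andbF add0r addr_ge0 ?sumr_ge0 // => [|B _]; case: ifP.
have ge0s : 0 <= \sum_(B : {set clause n} | deficient k D B) (if B \subset S then W S else 0).
  by apply: sumr_ge0 => B _; case: ifP.
rewrite andbT; case: (boolP (hall_family k D S)) => [_|nd].
  by rewrite ler_wpDr // addr_ge0 //; case: ifP.
rewrite add0r; case: (ltnP D #|S|) => [_|SD]; first by rewrite ler_wpDr.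
rewrite add0r; have [SK|SK] := boolP (S \subset kclauses n k); last first.
  have /subsetPn[e eS eK] := SK.
  rewrite {1}/W /bvars (bigD1 e) //= /bvar /p /kweight (negPf eK).
  by rewrite !mul0r mulr0.
move: nd; rewrite /hall_family SK SD /= negb_forall => /existsP[B].
rewrite negb_imply -ltnNge => /andP[BS Bv].
rewrite (bigD1 B) /=; last first.
  rewrite /deficient (fintype.subset_trans BS SK) Bv andbT.
  exact: leq_trans (subset_leq_card BS) SD.
by rewrite BS ler_wpDr // sumr_ge0 // => B' _; case: ifP.
Qed.

End Truncation.

(** * The jump after a point of bounded derivative *)

Definition gain (R : realType) n k (q theta : R) (c : clause n) : R :=
  bvar (kweight k q) c * prod_mean (kweight k q)
    (fun F => few theta (sols (c |: F)) - few theta (sols (F :\ c))).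

(** The literals satisfying [U] are padded with further variables to length exactly [D], so that
    symmetry can compare the resulting cubes. *)
Lemma cube_exists n D (U : {set clause n}) (X : {set 'I_n}) (s : assignment n) :
  (D <= n)%N -> (#|X| <= D)%N ->
  (forall c : clause n, c \in U ->
      exists l : literal n, [/\ l \in c, l.1 \in X & s l.1 = l.2]) ->
  exists t : seq (literal n), [/\ uniq (map fst t), size t = D &
    cube t \subset sols U].
Proof.
move=> Dn XD sU; pose vs := take D (enum X ++ enum (~: X)).
have szE : size (enum X ++ enum (~: X)) = n.
  by rewrite size_cat -!cardE cardsC card_ord.
exists [seq (v, s v) | v <- vs]; split.
- rewrite -map_comp map_id_in //; apply: take_uniq.
  rewrite cat_uniq !enum_uniq /= andbT; apply/hasPn => v.
  by rewrite !mem_enum !inE.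
- by rewrite size_map size_takel // szE.
apply/fintype.subsetP => s'; rewrite !inE => /allP s'v.
apply/forall_inP => c /sU[l [lc lX sl]]; apply/exists_inP; exists l => //.
have /s'v /= : (l.1, s l.1) \in [seq (v, s v) | v <- vs].
  apply: map_f; rewrite /vs take_cat -cardE; case: ltnP => XD'.
    by move: XD'; rewrite ltnNge XD.
  by rewrite mem_cat mem_enum lX.
by rewrite sl.
Qed.

(** Large sets and deficient sets each cost at most [V / 4], which leaves weight [V / 2] for the
    booster. Its gain [c1] is halved because [F] may already meet [U], and again because random
    literals may share a variable. *)
Lemma literal_boost (R : realType) (k : nat) (K V x : R) :
  0 < K -> 0 < V -> 1 <= x ->
  exists (D : nat) (b : R), 0 < b /\ exists n0 : nat, forall n, (n0 <= n)%N ->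
    forall q theta : R, 0 <= q <= 1 -> n%:R * q <= x ->
    \sum_(c : clause n) gain k q theta c <= K ->
    let P := prod_mean (kweight (n := n) k q) (fun F => few theta (sols F)) in
    V <= P * (1 - P) ->
    P + b <= prod_mean (kweight (n := n) k q)
      (fun F => avg_cut (@lit_sols n) D (few theta) (sols F)).
Proof.
move=> K0 V0 x1; have x0 : 0 < x by apply: lt_le_trans x1.
have [D [D0 KD]] : exists D : nat, (0 < D)%N /\ K / D%:R <= V / 4.
  have [n0 h] := eventually_div_le (ltW K0) (divr_gt0 V0 (ltr0n R 4)).
  by exists n0; have := h n0 (leqnn _).
have [c1 c1E] : exists c1, c1 = booster_gain K (V / 2) D by eexists.
have c10 : 0 < c1 by rewrite c1E; apply: booster_gain_gt0; rewrite ?divr_gt0.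
have c14 : 0 < c1 / 4 by rewrite divr_gt0.
have c12 : 0 < c1 / 2 by rewrite divr_gt0.
exists D, (c1 / 4); split=> //.
have [Q QE] : exists Q, Q = D.+1%:R * ((2 ^ (2 ^ (D * 2)))%:R * (4 * x) ^+ D) by eexists.
have Q0 : 0 <= Q by rewrite QE !mulr_ge0 // exprn_ge0 // mulr_ge0 // ltW.
have [n1 h1] := eventually_div_le Q0 (divr_gt0 V0 (ltr0n R 4)).
have [n2 h2] := eventually_div_le (mulr_ge0 (ler0n R D) (ltW x0)) c12.
have [n3 h3] := eventually_div_le (ler0n R (D ^ 2)) (divr_gt0 ltr01 (ltr0n R 2)).
exists (maxn n1 (maxn n2 (maxn n3 D))) => n; rewrite !geq_max.
move=> /and4P[/h1[n0 hQ] /h2[_ hD] /h3[_ hD2] Dn] q theta q01 nq gK P VP.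
pose p := kweight (n := n) k q.
have p01 c : 0 <= p c <= 1 by apply: kweight01.
have n0' : 0 < n%:R :> R by rewrite ltr0n.
pose few_pred (F : {set clause n}) : bool := #|sols F|%:R < theta.
have few_pred_mono (F G : {set clause n}) : F \subset G -> few_pred F -> few_pred G.
  move=> FG; rewrite /few_pred; apply: le_lt_trans.
  by rewrite ler_nat subset_leq_card // sols_antitone.
have [c fc] := chaos_exists p (fun F => few theta (sols F)).
have dW := hall_family_weight q01 n0 D0 x1 nq fc gK; rewrite -QE in dW.
have V2 : V / 2 <=
    \sum_(S : {set clause n} | hall_family k D S && (S != finset.set0)) c S ^+ 2 * bvars p S.
  by apply: le_trans dW; move: VP KD hQ; rewrite -/p -/P; lra.
have V20 : 0 < V / 2 by rewrite divr_gt0.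
have hallD (S : {set clause n}) : hall_family k D S -> (#|S| <= D)%N by case/and3P.
have [U [dU U0 bU]] := booster_exists p01 few_pred_mono fc K0 V20
   (@hall_family_sub n k D) hallD gK V2; rewrite -c1E in bU.
have /and3P[UK UD /forallP Uhall] := dU.
have [|X [s [XU sU]]] := @hall_satisfiable n U n0.
  by move=> B BU; have /implyP := Uhall B; apply.
have [t0 [ut0 st0 t0U]] := cube_exists Dn (leq_trans XU UD) sU.
have boost0 : P + c1 / 2 <= prod_mean p (fun F => few theta (sols F :&: cube t0)).
  (* [F] meets [U] with probability at most [D q <= D x / n]; when it does not, [F :\: U] is [F] and
     planting is compared with [F] itself. *)
  have hitU : prod_mean p (fun F => 1 - [disjoint F & U]%:R) <= c1 / 2.
    rewrite prod_meanB prod_mean_cst prod_mean_disjoint //.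
    have := bernoulli_ge #|U| q01.
    have : #|U|%:R * q <= c1 / 2.
      apply: le_trans hD; rewrite ler_pdivlMr // -mulrA ler_pM ?ler_nat ?mulr_ge0 //.
      - by case/andP: q01.
      - by rewrite mulrC.
    by move: (_ * q) (_ ^+ #|U|) => u y; lra.
  have step : prod_mean p (fun F => few theta (sols F)) + c1 <=
      prod_mean p (fun F => few theta (sols F :&: cube t0)) +
      prod_mean p (fun F => 1 - [disjoint F & U]%:R).
    apply: le_trans (lerD (lexx _) bU) _; rewrite -!prod_meanD.
    apply: ler_prod_mean => // F; rewrite addrCA -/(few theta (sols (F :|: U))) addrC.
    have FUle : few theta (sols (F :|: U)) <= few theta (sols F :&: cube t0).
      by apply: few_antitone; rewrite solsU finset.setIS.
    rewrite -/(few theta (sols (F :\: U))).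
    case: (boolP [disjoint F & U]) => FU /=.
      have -> : F :\: U = F by apply/setDidPl.
      move: FUle; lra.
    have := few_ge0 theta (sols (F :\: U)); have := few01 theta (sols F).
    by move: FUle; lra.
  by move: step hitU; rewrite -/P; lra.
have boost t : uniq (map fst t) -> size t = D ->
    P + c1 / 2 <= prod_mean p (fun F => few theta (sols F :&: cube t)).
  by move=> ut st; rewrite (@prod_mean_cube R n k q theta t t0) // st0 st.
have := avg_cut_cube_lower n0 Dn q01 (ltW c12) (lexx P) boost (r := D) (t := [::]) isT (add0n D).
under eq_prod_mean => F.
  have -> : sols F :&: cube [::] = sols F by apply/setP => s'; rewrite !inE andbT.
  over.
apply: le_trans; rewrite lerD2l (_ : c1 / 4 = c1 / 2 * (1 / 2)); last by field.
rewrite ler_wpM2l ?(ltW c12) //.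
have x01 : 0 <= (D%:R / n%:R : R) <= 1.
  by rewrite divr_ge0 // ler_pdivrMr // mul1r ler_nat.
apply: le_trans (bernoulli_ge D x01); rewrite mulrA -natrM mulnn.
by move: hD2; lra.
Qed.

Lemma geometric_small (R : realType) (x C : R) : 0 < x <= 1 -> 0 <= C ->
  exists m : nat, (1 - x) ^+ m * C <= 1 / 2.
Proof.
move=> /andP[x0 x1] C0; have C0' : 0 <= 2 * C / x by rewrite divr_ge0 ?mulr_ge0 // ltW.
have [m h] := eventually_div_le C0' ltr01; exists m.
have [m0 hm] := h m (leqnn _); have x01 : 0 <= x <= 1 by rewrite ltW.
have := bernoulli_le m x01; set y := _ ^+ m => y1.
have y0 : 0 <= y by rewrite exprn_ge0 // subr_ge0.
move: hm; rewrite ler_pdivrMr ?ltr0n // mul1r ler_pdivrMr // => hm.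
have : y * (2 * C) <= y * (1 + m%:R * x).
  by apply: ler_wpM2l => //; move: hm; lra.
by move: y1; lra.
Qed.

Lemma ffact_le n k : (n ^_ k <= n ^ k)%N.
Proof.
elim: k => [//|k IH]; rewrite ffactnSr expnSr leq_mul //; exact: leq_subr.
Qed.

Lemma nb_kclauses_le n k : (nb_kclauses n k <= (n * 2) ^ k)%N.
Proof.
rewrite /nb_kclauses expnMn leq_mul2r (leq_trans _ (ffact_le n k)) ?orbT //.
by rewrite -bin_ffact leq_pmulr // fact_gt0.
Qed.

Lemma rounds_ge (R : realType) n k (q : R) m f (F : {set clause n}) : 0 <= q <= 1 ->
  (forall F G : {set clause n}, F \subset G -> f F <= f G) ->
  f F <= rounds k q m f F.
Proof.
move=> q01 fm; elim: m F => [//|m IH] F /=.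
rewrite -[leLHS](@prod_mean_cst _ _ (kweight (n := n) k q)).
apply: ler_prod_mean => [c|G]; first exact: kweight01.
by apply: le_trans (IH _); apply: fm; apply: finset.subsetUl.
Qed.

(** The gain [c] is fixed before the increment [d']; only [n0] depends on [d']. *)
Lemma coarse_window_jump (R : realType) (k : nat) (K V x : R) : (0 < k)%N ->
  0 < K -> 0 < V -> 1 <= x ->
  exists c : R, 0 < c /\ forall d' : R, 0 < d' ->
  exists n0 : nat, forall n, (n0 <= n)%N ->
    forall q d theta : R, 0 <= q -> n%:R * q <= x -> 0 < theta ->
    d = d' * n%:R / (nb_kclauses n k)%:R -> q + d <= 1 ->
    \sum_(c : clause n) gain k q theta c <= K ->
    let P q := prod_mean (kweight (n := n) k q) (fun F => few theta (sols F)) in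
    V <= P q * (1 - P q) ->
    P q + c <= P (q + d).
Proof.
move=> k0 K0 V0 x1; have [D [b [b0 [n1 boost]]]] := literal_boost k K0 V0 x1.
have half_k : 0 < (2^-1 ^+ k : R) <= 1.
  by rewrite exprn_gt0 ?invr_gt0 //= exprn_ile1 ?invr_ge0 //; lra.
have [m mP] := geometric_small half_k (ler0n R (k ^ D)).
exists (b / 4); split; first by rewrite divr_gt0.
move=> d' d'0; pose M := (D + m)%N.
(* Formulas whose literal average is at most [tau] are given up, which sacrifices half of [b]. *)
have [tau tauE] : exists tau, tau = b / 2 by eexists.
have tau0 : 0 < tau by rewrite tauE divr_gt0.
(* Chosen so that [2 ^+ M * be] is what [few_blowup_slack] yields from an average of [tau]. *)
have [be beE] : exists be, be = tau ^+ (k ^ D) / 2 / 2 ^+ M by eexists.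
have be0 : 0 < be.
  by rewrite beE divr_gt0 ?divr_gt0 ?exprn_gt0.
(* The [M] batches fail with total probability at most 1/2; the successor keeps the divisor
   positive. *)
have [eta etaE] : exists eta : R, eta = (2 * M.+1%:R)^-1 by eexists.
have eta0 : 0 < eta by rewrite etaE invr_gt0 mulr_gt0.
pose C1 := k%:R ^+ k * M.+1%:R / (eta * (be / 2) * d').
have C10 : 0 <= C1.
  apply: divr_ge0; first by rewrite mulr_ge0 ?exprn_ge0.
  by rewrite !mulr_ge0 // ltW.
have be20 : 0 < be / 2 by rewrite divr_gt0.
have [n2 h2] := eventually_div_le C10 ltr01.
have [n3 h3] := eventually_div_le (ler0n R (k ^ 2)) be20.
exists (maxn n1 (maxn n2 (maxn n3 k))) => n; rewrite !geq_max.
move=> /and4P[n1n /h2[n0 hC] /h3[_ hk] kn] q d theta q0 nq th0 dE qd gK P VP.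
have n0' : 0 < n%:R :> R by rewrite ltr0n.
have N0 : 0 < (nb_kclauses n k)%:R :> R.
  by rewrite ltr0n muln_gt0 bin_gt0 kn expn_gt0.
have d0 : 0 <= d by rewrite dE divr_ge0 ?mulr_ge0 // ltW.
have q01 : 0 <= q <= 1 by rewrite q0; lra.
have aP := boost n n1n q theta q01 nq gK VP.
pose q2 := d / M.+1%:R.
have q20 : 0 <= q2 by rewrite divr_ge0.
have q2d : M%:R * q2 <= d.
  by rewrite /q2 mulrCA ler_piMr // ler_pdivrMr ?ltr0n // mul1r ler_nat.
have q21 : 0 <= q2 <= 1.
  by rewrite q20 /q2 ler_pdivrMr ?ltr0n // mul1r (@le_trans _ _ 1) ?ler1n //; lra.
have f_mono (F G : {set clause n}) : F \subset G -> few theta (sols F) <= few theta (sols G).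
  exact: few_sols_mono.
have T2 : 0 < (n * 2)%:R ^+ k :> R by rewrite exprn_gt0 // ltr0n muln_gt0 n0.
have miss (B : {set {ffun 'I_k -> literal n}}) : be * (n * 2)%:R ^+ k <= #|B|%:R ->
    prod_mean (kweight k q2) (fun G => (~~ [exists t in B, tuple_clause t \in G])%:R) <= eta.
  move=> Bbe; apply: (miss_prob n0 k0 kn q21 eta0 be0 hk Bbe).
  have : 1 <= d' * n%:R / (nb_kclauses n k)%:R * (n * 2)%:R ^+ k / (d' * n%:R).
    rewrite [leRHS](_ : _ = (n * 2)%:R ^+ k / (nb_kclauses n k)%:R); last first.
      by field; rewrite !gt_eqF.
    by rewrite ler_pdivlMr // mul1r -natrX ler_nat nb_kclauses_le.
  rewrite -dE ler_pdivlMr ?mulr_gt0 // mul1r => dn.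
  move: hC; rewrite /C1 ler_pdivrMr // mul1r ler_pdivrMr ?mulr_gt0 //.
  rewrite -ler_pdivlMr ?ltr0n // => /le_trans; apply.
  rewrite /q2 ler_pdivrMr ?ltr0n //.
  rewrite [leRHS](_ : _ = eta * (be / 2) * (d * (n * 2)%:R ^+ k)); last first.
    by field; rewrite gt_eqF // ltr0n.
  rewrite [leLHS](_ : _ = eta * (be / 2) * (d' * n%:R)); last by ring.
  by rewrite ler_wpM2l // mulr_ge0 // ltW.
pose a (F : {set clause n}) := avg_cut (@lit_sols n) D (few theta) (sols F).
have L0 : (0 < #|literal n|)%N by rewrite card_prod card_ord card_bool muln_gt0 n0.
have a01 F : 0 <= a F <= 1.
  apply/andP; split; first by apply: avg_cut_ge0 => // Y; apply: few_ge0.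
  rewrite -[leRHS](avg_cut_cst (@lit_sols n) L0 D 1 (sols F)).
  by apply: ler_avg_cut => Y; case/andP: (few01 theta Y).
(* If [few] is 1, the batches preserve it. If it is 0, either [a F <= tau] and the left side is not
   positive, or the batches succeed with probability at least 1/2. *)
have key F : few theta (sols F) + (a F - few theta (sols F) - tau) / 2 <=
    rounds k q2 M (fun F => few theta (sols F)) F.
  have /andP[a0 a1] := a01 F.
  have := rounds_ge k M F q21 f_mono => /= rge.
  have [z|z] : few theta (sols F) = 1 \/ few theta (sols F) = 0.
  - by rewrite /few; case: (_ < _)%R; [left|right].
  - by rewrite z in rge *; move: rge a1 tau0; move: (rounds _ _ _ _ _) => r; lra.
  rewrite z in rge *.
  have [aF|/ltW aF] := leP (a F) tau.
    by move: rge aF; move: (rounds _ _ _ _ _) => r; lra.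
  have -> : 0 + (a F - 0 - tau) / 2 = (a F - tau) / 2 by ring.
  apply: (@le_trans _ _ (1 - M%:R * eta)).
    have : M%:R * eta <= 1 / 2.
      rewrite etaE ler_pdivrMr ?mulr_gt0 // mulrA divrK ?unitfE //.
      by rewrite mul1r ler_nat.
    by lra.
  apply: (rounds_hit n0 q21 th0 be0 miss); rewrite beE mulrC divfK ?gt_eqF ?exprn_gt0 //.
  apply: le_trans (few_blowup_slack L0 k0 (fun s => avg_lit_sols R s n0) (sols F) th0 mP).
  by rewrite ler_wpM2r ?invr_ge0 // lerXn2r ?nnegrE ?(ltW tau0).
have p01 c : 0 <= kweight (n := n) k q c <= 1 by apply: kweight01.
have := ler_prod_mean p01 key.
have -> : prod_mean (kweight k q) (fun F : {set clause n} =>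
   few theta (sols F) + (a F - few theta (sols F) - tau) / 2) =
   P q + (prod_mean (kweight k q) a - P q - tau) / 2.
  rewrite prod_meanD; congr (_ + _); under eq_prod_mean => F do rewrite mulrC.
  by rewrite prod_meanZ !prod_meanB prod_mean_cst mulrC.
have : prod_mean (kweight k q)
    (rounds k q2 M (fun F : {set clause n} => few theta (sols F))) <= P (q + d).
  have qM : q + M%:R * q2 <= 1 by move: q2d qd; lra.
  apply: (le_trans (rounds_mean k q20 q0 qM f_mono)).
  apply: prod_mean_kweight_mono => //; last by lra.
  by rewrite addr_ge0 // mulr_ge0.
by move: aP; rewrite -/(P q) -/a tauE; lra.
Qed.

(** * Sharpness of the window *)

Lemma deriv_prod (R : comNzRingType) (I : finType) (G : I -> {poly R}) :
  (\prod_i G i)^`() = \sum_i (G i)^`() * \prod_(j | j != i) G j.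
Proof.
suff H (s : seq I) : uniq s ->
    (\prod_(i <- s) G i)^`() = \sum_(i <- s) (G i)^`() * \prod_(j <- s | j != i) G j.
  exact/H/index_enum_uniq.
elim: s => [|a s IH] /=; first by rewrite !big_nil derivC.
move=> /andP[as_ us]; rewrite !big_cons derivM eqxx IH // mulr_sumr; congr (_ + _).
  congr (_ * _); rewrite [RHS]big_seq_cond [LHS]big_seq_cond; apply: eq_bigl => j.
  by case: (boolP (j \in s)) => //= js; apply/esym; apply: contraNneq as_ => <-.
rewrite big_seq_cond [RHS]big_seq_cond; apply: eq_bigr => i /andP[is_ _].
have ai : a != i by apply: contraNneq as_ => ->.
by rewrite big_cons ai mulrCA.
Qed.

(** The Margulis-Russo formula as a polynomial identity, with a separate probability for each
    element. *)
Lemma deriv_prod_mean (R : comNzRingType) (T : finType) (W : T -> {poly R})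
    (f : {set T} -> R) :
  (prod_mean W (fun F => (f F)%:P))^`() =
  \sum_e (W e)^`() * prod_mean W (fun F => (f (e |: F) - f (F :\ e))%:P).
Proof.
rewrite /prod_mean raddf_sum /=.
under eq_bigr => F _ do rewrite derivM derivC mulr0 addr0 deriv_prod mulr_suml.
rewrite exchange_big; apply: eq_bigr => e _ /=.
rewrite -/(prod_mean _ _) (prod_mean_notin _ e) (sum_mem_notin e) mulr_sumr.
apply: eq_bigr => F eF; rewrite setU11 (negPf eF).
have -> : F :\ e = F by apply/setDidPl; rewrite disjoint_sym disjoints1.
rewrite setU1K // finset.setUA finset.setUid.
under eq_bigr => x xe do rewrite !inE (negPf xe) /=.
by rewrite derivB derivC polyCB; ring.
Qed.

Section Threshold.
Variables (R : realType) (n k : nat) (theta : R).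
Let H (q : R) := prod_mean (kweight (n := n) k q) (fun F => few theta (sols F)).

(** By Russo's formula the total influence at [q] is [q (1 - q)] times the derivative of [H], hence
    at most [q] times the slope given by the mean value theorem. *)
Lemma mean_value_gain (q1 q2 : R) : 0 <= q1 -> q1 < q2 -> q2 <= 1 ->
  exists q, [/\ q1 < q, q < q2 &
    \sum_(c : clause n) gain k q theta c <= q * ((H q2 - H q1) / (q2 - q1))].
Proof.
move=> q10 q12 q21; pose W (c : clause n) : {poly R} := if c \in kclauses n k then 'X else 0.
pose Hp := prod_mean W (fun F : {set clause n} => (few theta (sols F))%:P).
have WE q c : (W c).[q] = kweight k q c.
  by rewrite /W /kweight; case: ifP; rewrite ?hornerX ?horner0.
have meanE q (f : {set clause n} -> R) :
    (prod_mean W (fun F => (f F)%:P)).[q] = prod_mean (kweight k q) f.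
  rewrite /prod_mean horner_sum; apply: eq_bigr => F _.
  rewrite hornerM hornerC horner_prod; congr (_ * _); apply: eq_bigr => c _.
  by case: ifP => _; [exact: WE | rewrite hornerD hornerN hornerC WE].
have [q + qE] := poly_mvt Hp q12; rewrite in_itv /= => /andP[q1q qq2].
have q01 : 0 <= q <= 1 by apply/andP; split; lra.
exists q; split=> //.
rewrite -[H q2]meanE -[H q1]meanE -/Hp qE mulfK; last by rewrite subr_eq0 gt_eqF.
rewrite deriv_prod_mean horner_sum mulr_sumr; apply: ler_sum => c _.
rewrite hornerM meanE /gain /bvar /W /kweight.
case: ifP => _; last by rewrite deriv0 horner0 !mul0r mulr0.
rewrite derivX hornerC mul1r; apply: ler_wpM2r; last first.
  by rewrite ler_piMr; lra.
apply: prod_mean_ge0 => [e|F]; first exact: kweight01.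
rewrite subr_ge0 few_sols_mono // (fintype.subset_trans (subsetDl _ _)) //.
exact: finset.subsetUr.
Qed.

(** Each choice of [k] variables carries a clause all of whose literals are false under [s]. *)
Lemma card_violated (s : assignment n) :
  ('C(n, k) <= #|[set c in kclauses n k | ~~ sat_clause s c]|)%N.
Proof.
pose cl (I : {set 'I_n}) : clause n := [set (i, ~~ s i) | i in I].
have fstcl I : [set l.1 | l in cl I] = I.
  by rewrite -imset_comp (eq_imset _ (_ : _ =1 id)) ?imset_id.
have cli : injective cl by move=> I J IJ; rewrite -[I]fstcl IJ fstcl.
rewrite -[n in 'C(n, _)]card_ord -card_draws -(card_imset _ cli) subset_leq_card //.
apply/fintype.subsetP => c /imsetP[I I_k ->]; have cI : #|I| == k by move: I_k; rewrite inE.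
rewrite !inE /is_kclause fstcl cI card_imset ?cI /=; last by move=> i j [].
by apply/exists_inP => -[_ /imsetP[i _ ->]] /=; case: (s i).
Qed.

(** Markov's inequality: as [theta >= 1], the event can fail only if some assignment survives. *)
Lemma first_moment (q : R) : 0 <= q <= 1 -> 1 <= theta ->
  1 - 2 ^+ n * (1 - q) ^+ 'C(n, k) <= H q.
Proof.
move=> q01 th1; have p01 c : 0 <= kweight (n := n) k q c <= 1 by apply: kweight01.
apply: (@le_trans _ _ (prod_mean (kweight k q) (fun F : {set clause n} => 1 - #|sols F|%:R))).
  rewrite prod_meanB prod_mean_cst lerD2l lerN2.
  have -> : prod_mean (kweight k q) (fun F : {set clause n} => #|sols F|%:R : R) =
      \sum_(s : assignment n) (1 - q) ^+ #|[set c in kclauses n k | ~~ sat_clause s c]|.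
    transitivity (prod_mean (kweight k q) (fun F : {set clause n} =>
      \sum_(s : assignment n)
        [disjoint F & [set c in kclauses n k | ~~ sat_clause s c]]%:R)).
      apply: eq_bigr => F _; have [->|w0] := eqVneq (prod_weight (kweight k q) F) 0.
        by rewrite !mul0r.
      have FK : F \subset kclauses n k.
        apply: contraNT w0 => /subsetPn[c cF cK].
        by rewrite /prod_weight (bigD1 c) //= cF /kweight (negPf cK) mul0r.
      congr (_ * _); rewrite -sum1_card natr_sum big_mkcond; apply: eq_bigr => s _.
      suff -> : (s \in sols F) = [disjoint F & [set c in kclauses n k | ~~ sat_clause s c]].
        by case: [disjoint _ & _].
      rewrite inE; apply/forall_inP/pred0P => [sat c|dis c cF] /=.
        case: (boolP (c \in F)) => //= cF; rewrite inE.
        by rewrite (sat _ cF) andbF.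
      have := dis c; rewrite /= cF inE (fintype.subsetP FK) //= => /negbT.
      by rewrite negbK.
    rewrite prod_mean_sum; apply: eq_bigr => s _; apply: prod_mean_disjoint.
    by apply/fintype.subsetP => c; rewrite inE => /andP[].
  apply: (@le_trans _ _ (\sum_(s : assignment n) (1 - q) ^+ 'C(n, k))).
    by apply: ler_sum => s _; rewrite ler_wiXn2l ?card_violated //; lra.
  by rewrite sumr_const card_ffun card_bool card_ord -natrX mulr_natl.
apply: ler_prod_mean => // F; rewrite /few; case: ltP => /= [_|thF].
  by rewrite gerBl.
by rewrite subr_le0 (le_trans th1).
Qed.

End Threshold.

(** * The window in terms of the density alpha *)

Lemma nb_kclauses_ge n k : (2 <= k)%N -> (k.*2 <= n)%N ->
  (n ^ 2 <= nb_kclauses n k * k`!)%N.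
Proof.
move=> k2 kn; rewrite /nb_kclauses mulnAC bin_ffact.
have nk : (k <= n)%N by lia.
apply: (@leq_trans ((n - k) ^ k * 2 ^ k)); last by rewrite leq_mul2r ffact_ge ?orbT.
rewrite -expnMn; apply: (@leq_trans (n ^ k)).
  by apply: leq_pexp2l => //; lia.
by rewrite leq_exp2r; lia.
Qed.

Section Alpha.
Variables (R : realType) (k : nat) (phi : R).
Hypothesis k2 : (2 <= k)%N.
Hypothesis phi01 : 0 <= phi < 1.

Let theta n : R := 2 `^ (n%:R * phi).
Let lam n : R := n%:R / (nb_kclauses n k)%:R.
Let H n (q : R) := prod_mean (kweight (n := n) k q) (fun F => few (theta n) (sols F)).

Lemma theta_ge1 n : 1 <= theta n.
Proof.
case/andP: phi01 => p0 _; rewrite /theta -[leLHS](powRr0 2) ler_powR ?ler1n //.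
by rewrite mulr_ge0.
Qed.

Lemma mean_few_mono n (q q' : R) : 0 <= q -> q <= q' -> q' <= 1 -> H n q <= H n q'.
Proof. by move=> q0 qq q1; apply: prod_mean_kweight_mono => // F G; apply: few_sols_mono. Qed.

Lemma mean_few01 n (q : R) : 0 <= q <= 1 -> 0 <= H n q <= 1.
Proof.
move=> q01; have p01 c : 0 <= kweight (n := n) k q c <= 1 by apply: kweight01.
apply/andP; split; first by apply: prod_mean_ge0 => // F; apply: few_ge0.
rewrite -[leRHS](prod_mean_cst (kweight (n := n) k q)); apply: ler_prod_mean => // F.
by case/andP: (few01 (theta n) (sols F)).
Qed.

Lemma clause_prob01 n (a : R) : 0 <= clause_prob n k a <= 1.
Proof.
by rewrite /clause_prob le_min ler01 le_max lexx /= ge_min lexx.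
Qed.

Lemma clause_prob_mono n (a b : R) : a <= b -> clause_prob n k a <= clause_prob n k b.
Proof.
move=> ab; rewrite /clause_prob; apply: le_min2 => //; apply: le_max2 => //.
by rewrite ler_wpM2r ?invr_ge0 // ler_wpM2r.
Qed.

Lemma clause_probE n (a : R) : 0 <= a -> a * lam n <= 1 -> clause_prob n k a = a * lam n.
Proof.
move=> a0 al; have l0 : 0 <= lam n by rewrite /lam divr_ge0.
rewrite /clause_prob -mulrA -/(lam n) max_r ?mulr_ge0 //.
by rewrite min_r.
Qed.

Lemma P_few_sat_mono n (a b : R) : a <= b -> P_few_sat n k a phi <= P_few_sat n k b phi.
Proof.
move=> ab; rewrite !P_few_satE; apply: mean_few_mono; rewrite ?clause_prob_mono //.
  by case/andP: (clause_prob01 n a).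
by case/andP: (clause_prob01 n b).
Qed.

Lemma P_few_sat01 n (a : R) : 0 <= P_few_sat n k a phi <= 1.
Proof. by rewrite P_few_satE; apply: mean_few01; apply: clause_prob01. Qed.

Lemma P_few_sat_le0 n (a : R) : a <= 0 -> P_few_sat n k a phi = 0.
Proof.
move=> a0; rewrite P_few_satE.
have -> : clause_prob n k a = 0.
  rewrite /clause_prob max_l ?min_r ?ler01 //.
  by rewrite mulr_le0_ge0 ?invr_ge0 // mulr_le0_ge0.
rewrite /prod_mean (bigD1 finset.set0) //= big1 ?addr0 => [|F /set0Pn[c cF]].
  rewrite /few (_ : #|sols _| = 2 ^ n)%N; last first.
    have -> : sols (finset.set0 : cnf n) = [set: assignment n].
      by apply/setP => s; rewrite !inE; apply/forall_inP => c; rewrite inE.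
    by rewrite cardsT card_ffun card_bool card_ord.
  rewrite ltNge natrX -powR_mulrn // /theta ler_powR ?ler1n ?mulr0 //.
  by case/andP: phi01 => _ p1; rewrite ler_piMr // ltW.
by rewrite /prod_weight (bigD1 c) //= cF /kweight if_same !mul0r.
Qed.

(** The last bound is where [k >= 2] enters: [N] has order at least [n ^ 2], so [n] times the clause
    probability stays bounded, as the rarity of deficient sets requires. *)
Lemma eventually_lam (C : R) : 0 < C ->
  exists n0 : nat, forall n, (n0 <= n)%N ->
    [/\ (0 < n)%N, (k <= n)%N, 0 < lam n, C * lam n <= 1 & n%:R * lam n <= k`!%:R].
Proof.
move=> C0; have C0' : 0 <= C * k`!%:R by rewrite mulr_ge0 // ltW.
have [n0 h0] := eventually_div_le C0' ltr01.
exists (maxn n0 k.*2) => n; rewrite geq_max => /andP[/h0[n_gt0 hC] kn].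
have kn' : (k <= n)%N by lia.
have n0' : 0 < n%:R :> R by rewrite ltr0n.
have N0 : 0 < (nb_kclauses n k)%:R :> R.
  by rewrite ltr0n muln_gt0 bin_gt0 kn' expn_gt0.
have nl : n%:R * lam n <= k`!%:R.
  rewrite /lam mulrA ler_pdivrMr // -!natrM ler_nat mulnn mulnC.
  exact: nb_kclauses_ge.
split=> //; first by rewrite /lam divr_gt0.
apply: le_trans hC; rewrite ler_pdivlMr // -mulrA ler_wpM2l ?(ltW C0) //.
by rewrite mulrC.
Qed.

(** At this density an assignment falsifies [2 n] clauses on average, so the mean number of
    solutions is at most [2 ^ n * exp(- 2 n) <= 2 ^ (- n)]. *)
Definition alpha_max : R := 2 ^+ k.+1.

Lemma P_few_sat_max (delta : R) : 0 < delta ->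
  exists n0 : nat, forall n, (n0 <= n)%N ->
    1 - delta <= P_few_sat n k alpha_max phi.
Proof.
move=> d0; have am0 : 0 < alpha_max by rewrite exprn_gt0.
have [n1 h1] := eventually_lam am0.
have [n2 h2] := eventually_div_le (ler0n R 2) d0.
exists (maxn n1 n2) => n; rewrite geq_max => /andP[/h1[n0 kn l0 al1 _] /h2[_ hd]].
rewrite P_few_satE clause_probE ?(ltW am0) //; set q := _ * _ in al1 *.
have q01 : 0 <= q <= 1 by rewrite al1 mulr_ge0 ?ltW.
apply: le_trans (@first_moment R n k (theta n) q q01 (theta_ge1 n)).
rewrite lerD2l lerN2; apply: le_trans hd.
have qC : q * 'C(n, k)%:R = n%:R * 2.
  rewrite /q /lam /nb_kclauses /alpha_max natrM natrX exprS; field.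
  by rewrite !gt_eqF ?exprn_gt0 // ltr0n bin_gt0.
have e4 : expR (- 2) <= 4^-1 :> R.
  rewrite expRN lef_pV2 ?posrE ?expR_gt0 // (_ : 2 = 1 + 1 :> R) // expRD.
  have := expR_ge1Dx (1 : R); nra.
have : (1 - q) ^+ 'C(n, k) <= 4^-1 ^+ n.
  apply: (@le_trans _ _ (expR (- q) ^+ 'C(n, k))).
    rewrite lerXn2r ?nnegrE ?expR_ge0 ?expR_ge1Dx //.
    by case/andP: q01; rewrite subr_ge0.
  rewrite -expRM_natl mulrN mulrC qC -mulrN expRM_natl lerXn2r ?nnegrE ?expR_ge0 //.
move=> h4; apply: (@le_trans _ _ (2 ^+ n * 4^-1 ^+ n)).
  by rewrite ler_wpM2l ?exprn_ge0.
rewrite -exprMn (_ : 2 * 4^-1 = 1 - 2^-1 :> R); last by field.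
rewrite ler_pdivlMr ?ltr0n //.
have h01 : 0 <= (2^-1 : R) <= 1 by apply/andP; split; lra.
have := bernoulli_le n h01; have : 0 <= (1 - 2^-1 : R) ^+ n by rewrite exprn_ge0 //; lra.
by move: (_ ^+ n) => y; lra.
Qed.

(* Cut [eps] into [J] steps of length [2 * d'].  On each step either the first
   half already gains [2 / J], or it contains a point of derivative at most
   [4 / eps], after which the second half gains [c]; and [c] does not depend on
   [J]. *)
Lemma sharp_window (eps delta : R) : 0 < eps -> 0 < delta < 1 ->
  exists n0 : nat, forall n, (n0 <= n)%N -> forall b : R,
    delta <= P_few_sat n k b phi -> 1 - delta <= P_few_sat n k (b + eps) phi.
Proof.
move=> e0 /andP[d0 d1].
have am0 : 0 < alpha_max by rewrite exprn_gt0.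
have am1 : 1 <= alpha_max by rewrite exprn_ege1 // ler1n.
have V0 : 0 < delta * (1 - delta) by rewrite mulr_gt0 // subr_gt0.
(* A rise of [2 / J] over the half step [eps / (2 J)] has slope [4 / eps]; [alpha_max] bounds the
   factor [q] of [mean_value_gain], up to scaling. *)
have K0 : 0 < alpha_max * (4 / eps) by rewrite mulr_gt0 // divr_gt0.
have x1 : 1 <= alpha_max * k`!%:R.
  by rewrite -[leLHS]mulr1 ler_pM ?ler1n ?fact_gt0.
have k0 : (0 < k)%N by apply: leq_trans k2.
have [c [c0 jumpc]] := coarse_window_jump k0 K0 V0 x1.
have [J [J0 Jc]] : exists J : nat, (0 < J)%N /\ 1 < J%:R * c.
  have [J hJ] := eventually_div_le (ler0n R 2) c0.
  exists J; have [J0 h] := hJ J (leqnn _); split=> //.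
  by move: h; rewrite ler_pdivrMr ?ltr0n //; lra.
have J0' : 0 < J%:R :> R by rewrite ltr0n.
pose d' : R := eps / (2 * J%:R).
have d'0 : 0 < d' by rewrite divr_gt0 ?mulr_gt0.
have [n1 h1] := jumpc d' d'0.
have [n2 h2] := P_few_sat_max d0.
have [n3 h3] := eventually_lam (addr_gt0 am0 e0).
exists (maxn n1 (maxn n2 n3)) => n; rewrite !geq_max.
move=> /and3P[n1n n2n n3n] b bd; rewrite leNgt; apply/negP => bed.
have [n0 kn l0 al1 nl] := h3 n n3n.
(* The window lies between 0 and [alpha_max], where [clause_prob] is not truncated. *)
have b0 : 0 < b.
  rewrite ltNge; apply/negP => b0.
  by move: bd; rewrite P_few_sat_le0 // leNgt d0.
have bam : b + eps < alpha_max.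
  rewrite ltNge; apply/negP => /(P_few_sat_mono n) h.
  by have := h2 n n2n; lra.
have PH (a : R) : 0 <= a -> a <= b + eps -> P_few_sat n k a phi = H n (a * lam n).
  move=> a0 ab; rewrite P_few_satE clause_probE //.
  apply: le_trans al1; rewrite ler_wpM2r ?(ltW l0) //; lra.
have mid (a : R) : b <= a -> a <= b + eps ->
    delta <= H n (a * lam n) /\ H n (a * lam n) <= 1 - delta.
  move=> ba abe; rewrite -PH //; last by lra.
  have := P_few_sat_mono n ba; have := P_few_sat_mono n abe; lra.
have lam1 (a : R) : a <= b + eps -> a * lam n <= 1.
  by move=> ab; apply: le_trans al1; rewrite ler_wpM2r ?(ltW l0) //; lra.
have lamm (a a' : R) : a <= a' -> a * lam n <= a' * lam n.
  by move=> aa'; rewrite ler_wpM2r // ltW.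
pose gap := Num.min c (2 / J%:R).
have step (a : R) : b <= a -> a + 2 * d' <= b + eps ->
    H n (a * lam n) + gap <= H n ((a + 2 * d') * lam n).
  move=> ba abe; have a0 : 0 <= a by lra.
  have lam1' := lam1 _ abe.
  have [big|small] := leP (2 / J%:R) (H n ((a + d') * lam n) - H n (a * lam n)).
    apply: (@le_trans _ _ (H n ((a + d') * lam n))).
      have : gap <= 2 / J%:R by rewrite ge_min lexx orbT.
      by move: big; lra.
    apply: mean_few_mono => //; last by apply: lamm; lra.
    by rewrite mulr_ge0 ?(ltW l0) //; lra.
  have al0 : 0 <= a * lam n by rewrite mulr_ge0 ?(ltW l0).
  have adl : a * lam n < (a + d') * lam n by rewrite ltr_pM2r // ltrDl.
  have ad1 : (a + d') * lam n <= 1 by apply: lam1; lra.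
  have [q [aq qa gq]] := @mean_value_gain R n k (theta n) _ _ al0 adl ad1.
  have [al [qE aal ald]] : exists al, [/\ q = al * lam n, a < al & al < a + d'].
    exists (q / lam n); split; first by rewrite divfK // gt_eqF.
      by rewrite ltr_pdivlMr.
    by rewrite ltr_pdivrMr.
  have gK : \sum_(c : clause n) gain k q (theta n) c <= alpha_max * (4 / eps).
    apply: le_trans gq _; rewrite -/(H n _) -/(H n _) -mulrBl (_ : a + d' - a = d'); last by ring.
    set dH := H n _ - _; have dH2 : dH <= 2 / J%:R := ltW small.
    apply: (@le_trans _ _ (alpha_max * lam n * ((2 / J%:R) / (d' * lam n)))).
      have q_ge0 : 0 <= q by apply: ltW; apply: le_lt_trans aq.
      have dl0 : 0 <= (d' * lam n)^-1 by rewrite invr_ge0 mulr_ge0 // ltW.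
      apply: ler_pM => //.
      - rewrite mulr_ge0 // subr_ge0; by apply: mean_few_mono => //; apply: ltW.
      - by rewrite qE ler_wpM2r ?(ltW l0) //; lra.
      - by rewrite ler_wpM2r.
    rewrite le_eqVlt; apply/orP; left; apply/eqP; rewrite /d'; field.
    by rewrite !gt_eqF.
  have [m1 m2] : delta <= H n q /\ H n q <= 1 - delta.
    by rewrite qE; apply: mid; lra.
  have q0 : 0 <= q by lra.
  have th0 : 0 < theta n by apply: lt_le_trans (theta_ge1 n).
  have nq : n%:R * q <= alpha_max * k`!%:R.
    rewrite qE mulrCA ler_pM ?mulr_ge0 ?(ltW l0) //; lra.
  have qd1 : q + d' * lam n <= 1.
    by rewrite qE -mulrDl; apply: lam1; lra.
  have := h1 n n1n q (d' * lam n) (theta n) q0 nq th0 (mulrA _ _ _) qd1 gK.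
  rewrite /= -/(H n q) -/(H n (q + d' * lam n)) => /(_ _) jq.
  have {}jq : H n q + c <= H n (q + d' * lam n).
    by apply: jq; nra.
  have gc : gap <= c by rewrite ge_min lexx.
  have aH : H n (a * lam n) <= H n q.
    by apply: mean_few_mono => //; [exact: ltW | lra].
  have Ha : H n (q + d' * lam n) <= H n ((a + 2 * d') * lam n).
    apply: mean_few_mono => //; first by rewrite addr_ge0 // mulr_ge0 ?(ltW l0) ?(ltW d'0).
    by rewrite qE -mulrDl; apply: lamm; lra.
  by move: jq gc aH Ha; lra.
have climb j : (j <= J)%N -> H n (b * lam n) + j%:R * gap <= H n ((b + j%:R * (2 * d')) * lam n).
  have Jd : J%:R * (2 * d') = eps.
    by rewrite /d'; field; rewrite gt_eqF.
  elim: j => [|j IH] jJ; first by rewrite !mul0r !addr0.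
  have jd : j.+1%:R * (2 * d') <= eps.
    by rewrite -Jd ler_wpM2r ?ler_nat // mulr_ge0 // ltW.
  have jd0 : 0 <= j%:R * (2 * d') by rewrite !mulr_ge0 // ltW.
  have jE : b + j.+1%:R * (2 * d') = b + j%:R * (2 * d') + 2 * d'.
    by rewrite -[j.+1%:R]natr1; ring.
  have e1 : b <= b + j%:R * (2 * d') by lra.
  have e2 : b + j%:R * (2 * d') + 2 * d' <= b + eps by rewrite -jE lerD2l.
  have := step _ e1 e2; rewrite -jE; apply: le_trans.
  have := IH (ltnW jJ); rewrite -[j.+1%:R]natr1; lra.
have := climb J (leqnn _).
have -> : J%:R * (2 * d') = eps by rewrite /d'; field; rewrite gt_eqF.
have : 1 < J%:R * gap.
  rewrite /gap minEle; case: ifP => _; first exact: Jc.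
  by rewrite mulrCA divff ?gt_eqF // mulr1; lra.
have [m1 _] : delta <= H n (b * lam n) /\ H n (b * lam n) <= 1 - delta.
  by apply: mid; lra.
have [_ m2] : delta <= H n ((b + eps) * lam n) /\ H n ((b + eps) * lam n) <= 1 - delta.
  by apply: mid; lra.
by lra.
Qed.

End Alpha.

Local Open Scope classical_set_scope.

Theorem theorem2 (R : realType) (k : nat) (hk : (2 <= k)%N)
    (eps : R) (heps : 0 < eps) (phi : R) (hphi : 0 <= phi < 1) :
  exists alpha : nat -> R,
    (P_few_sat n k (alpha n - eps) phi @[n --> \oo] --> (0 : R)) /\
    (P_few_sat n k (alpha n + eps) phi @[n --> \oo] --> (1 : R)).
Proof.
have e2 : 0 < eps / 2 by rewrite divr_gt0.
(* A grid of mesh [eps / 2] gives a first point of probability at least 1/2 without appeal to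
   continuity. The default 0 below can occur only for finitely many [n]. *)
pose reached n (j : nat) := 1 / 2 <= P_few_sat n k (j%:R * (eps / 2)) phi.
pose alpha n : R :=
  if pselect (exists j, reached n j) is left h then (ex_minn h)%:R * (eps / 2) else 0.
have [n1 alphaP] : exists n1 : nat, forall n, (n1 <= n)%N ->
    1 / 2 <= P_few_sat n k (alpha n) phi /\
    P_few_sat n k (alpha n - eps / 2) phi < 1 / 2.
  have half0 : 0 < (1 / 2 : R) by rewrite divr_gt0.
  have [n1 h1] := P_few_sat_max hk hphi half0.
  exists n1 => n /h1 hn; rewrite /alpha; case: pselect => [h|nh]; last first.
    case: nh; exists (Num.bound (alpha_max R k / (eps / 2))).
    apply: le_trans (_ : P_few_sat n k (alpha_max R k) phi <= _); first by move: hn; lra.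
    apply: P_few_sat_mono => //; rewrite -ler_pdivrMr //; apply: ltW; apply: archi_boundP.
    by rewrite divr_ge0 ?exprn_ge0 // ltW.
  case: ex_minnP => j jr jmin; split; first exact: jr.
  (* At [j = 0] the preceding grid point is negative, and there the formula is empty. *)
  case: j jr jmin => [|j] jr jmin.
    by rewrite mul0r sub0r P_few_sat_le0 // oppr_le0 ltW.
  rewrite -[j.+1%:R]natr1 mulrDl mul1r addrK ltNge; apply/negP => /jmin.
  by rewrite ltnn.
exists alpha; split; apply/cvgrPdist_le => e e0.
  (* A probability of at least this level at [alpha n - eps] would force at least 3/4 at
     [alpha n - eps / 2], where it is below 1/2. *)
  have dl : 0 < Num.min e (1 / 4) < 1.
    by rewrite lt_min e0 gt_min; apply/andP; split; [lra|apply/orP; right; lra].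
  have [n2 h2] := sharp_window hk hphi e2 dl.
  exists (maxn n1 n2) => // n; rewrite /= geq_max => /andP[/alphaP[_ aP] n2n].
  have /andP[P0 _] := P_few_sat01 k phi n (alpha n - eps).
  rewrite sub0r normrN ger0_norm // leNgt; apply/negP => /ltW eP.
  have : Num.min e (1 / 4) <= P_few_sat n k (alpha n - eps) phi.
    by rewrite ge_min eP.
  move/(h2 n n2n); rewrite (_ : alpha n - eps + eps / 2 = alpha n - eps / 2); last by field.
  have : Num.min e (1 / 4) <= 1 / 4 by rewrite ge_min lexx orbT.
  by move: aP; lra.
have dl : 0 < Num.min e (1 / 2) < 1.
  by rewrite lt_min e0 gt_min; apply/andP; split; [lra|apply/orP; right; lra].
have [n2 h2] := sharp_window hk hphi heps dl.
exists (maxn n1 n2) => // n; rewrite /= geq_max => /andP[/alphaP[aP _] n2n].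
have /andP[_ P1] := P_few_sat01 k phi n (alpha n + eps).
rewrite ger0_norm ?subr_ge0 //.
have : Num.min e (1 / 2) <= P_few_sat n k (alpha n) phi.
  by apply: le_trans aP; rewrite ge_min lexx orbT.
move/(h2 n n2n).
have : Num.min e (1 / 2) <= e by rewrite ge_min lexx.
by lra.
Qed.
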